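(* Let $(M_i,g_i)$, $i=1,2$, be pseudo-Riemannian manifolds and let $f_i:M_i\to(0,\infty)$ be smooth positive functions. The cometric $\widetilde G_{f_1f_2}$ of $G_{f_1f_2}$ is given by $$\widetilde G_{f_1f_2}=\Big(\frac1{f_2^v}\Big)^2\widetilde g_1^{\,h}+\Big(\frac1{f_1^h}\Big)^2\widetilde g_2^{\,v}+\frac{1}{1-c^2b_1^hb_2^v}\Big\{\frac{c^2b_2^v}{(f_2^v)^2}(\mathrm{grad} f_1)^h\otimes(\mathrm{grad} f_1)^h+\frac{c^2b_1^h}{(f_1^h)^2}(\mathrm{grad} f_2)^v\otimes(\mathrm{grad} f_2)^v-\frac{c}{f_1^hf_2^v}(\mathrm{grad} f_1)^h\odot(\mathrm{grad} f_2)^v\Big\}.$$ It is the unique tensor field such that, for all 1-forms $\alpha_i,\beta_i\in\Gamma(T^*M_i)$ $(i=1,2)$, $$\widetilde G_{f_1f_2}(\alpha_i^I,\beta_i^I)=\frac{1}{(f_j^J)^2}\Big\{\widetilde g_i(\alpha_i,\beta_i)^I+\frac{c^2b_j^J}{1-c^2b_1^hb_2^v}\,\widetilde g_i(\alpha_i,df_i)^I\,\widetilde g_i(\beta_i,df_i)^I\Big\}$$ and, for $i\neq k$, $$\widetilde G_{f_1f_2}(\alpha_i^I,\beta_k^K)=\frac{-c}{f_1^hf_2^v(1-c^2b_1^hb_2^v)}\,\widetilde g_i(\alpha_i,df_i)^I\,\widetilde g_k(\beta_k,df_k)^K,$$ where $j=3-i$ and $(i,I),(k,K),(j,J)\in\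{(1,h),(2,v)\}$.
   Context: $\pi_i:M_1\times M_2\to M_i$ are the projections; functions and forms on $M_1$ (resp. $M_2$) are lifted horizontally (resp. vertically) by pullback: $\varphi_1^h=\varphi_1\circ\pi_1$, $\alpha_1^h=\pi_1^*\alpha_1$, $\varphi_2^v=\varphi_2\circ\pi_2$, $\alpha_2^v=\pi_2^*\alpha_2$. The horizontal lift $X_1^h$ of a vector field $X_1$ on $M_1$ is the vector field on $M_1\times M_2$ with $d\pi_1(X_1^h)=X_1\circ\pi_1$, $d\pi_2(X_1^h)=0$; the vertical lift $X_2^v$ of a vector field on $M_2$ is defined symmetrically; contravariant tensors are lifted accordingly. $c$ is a real number and $$G_{f_1f_2}=(f_2^v)^2\pi_1^*g_1+(f_1^h)^2\pi_2^*g_2+c f_1^hf_2^v\,df_1^h\odot df_2^v,$$ with $\alpha\odot\beta=\alpha\otimes\beta+\beta\otimes\alpha$. $\mathrm{grad} f_i$ is the $g_i$-gradient and $b_i=\|\mathrm{grad} f_i\|^2=g_i(\mathrm{grad} f_i,\mathrm{grad} f_i)$. Standing assumption: $0\le c^2b_1^hb_2^v<1$ on $M_1\times M_2$. The cometric of a metric is the induced (inverse) bilinear form on 1-forms; $\widetilde g_i$ is the cometric of $g_i$. *)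

(* Defs.v *)
From HB Require Import structures.
From mathcomp Require Import all_boot all_order all_algebra.
From mathcomp Require Import all_classical all_reals all_analysis.
Set Implicit Arguments.
Unset Strict Implicit.
Unset Printing Implicit Defensive.
Import Order.TTheory GRing.Theory Num.Theory.
Import numFieldNormedType.Exports.
Local Open Scope classical_set_scope.
Local Open Scope ring_scope.

(* Conventions.  A manifold carries an atlas together with a preferred chart
   at each point p, and T_pM is R^n read in that preferred chart:
   - a vector of T_pM is a row u, a covector is a column a, and <a, u> = u *m a;
   - a bilinear form A on T_pM is evaluated by A(u, v) = u *m A *m v^T;
   - a bilinear form H on T*_pM is evaluated by H(a, b) = a^T *m H *m b;
   - a linear map T_pM -> T_qN is a matrix acting on rows from the right, which
     is the convention of the Jacobian 'J. *)

Section smooth_euclidean.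
Context {R : realType} {m : nat}.

Fixpoint Ck (k : nat) {W : normedModType R} (U : set 'rV[R]_m)
    (f : 'rV[R]_m -> W) : Prop :=
  match k with
  | 0 => {within U, continuous f}
  | k'.+1 => (forall x, U x -> differentiable f x) /\
             (forall v : 'rV[R]_m, Ck k' U (fun x => 'D_v f x))
  end.

(* Only meaningful for an open set U. *)
Definition smooth_on {W : normedModType R} (U : set 'rV[R]_m)
    (f : 'rV[R]_m -> W) : Prop := forall k, Ck k U f.

End smooth_euclidean.

(* The map cinv is only relevant on the image of cdom. *)
Record chart (R : realType) (n : nat) (M : topologicalType) := Chart {
  cdom : set M;
  cmap : M -> 'rV[R]_n;
  cinv : 'rV[R]_n -> M }.

Definition cimg (R : realType) (n : nat) (M : topologicalType)
    (phi : chart R n M) : set 'rV[R]_n := cmap phi @` cdom phi.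

Definition is_chart (R : realType) (n : nat) (M : topologicalType)
    (phi : chart R n M) : Prop :=
  [/\ open (cdom phi), open (cimg phi),
      (forall p, cdom phi p -> cinv phi (cmap phi p) = p),
      {within cdom phi, continuous (cmap phi)} &
      {within cimg phi, continuous (cinv phi)}].

Record charted (R : realType) (n : nat) (M : topologicalType) := Charted {
  atlas : set (chart R n M);
  chart_at : M -> chart R n M }.

Definition smooth_manifold (R : realType) (n : nat) (M : topologicalType)
    (A : charted R n M) : Prop :=
  [/\ hausdorff_space M, @second_countable M,
      (forall phi, atlas A phi -> is_chart phi),
      (forall p, atlas A (chart_at A p) /\ cdom (chart_at A p) p) &
      (forall phi psi, atlas A phi -> atlas A psi ->
         smooth_on (cmap phi @` (cdom phi `&` cdom psi))
                   (cmap psi \o cinv phi))].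

Section product.
Context {R : realType} {n1 n2 : nat} {M1 M2 : topologicalType}.

Definition prod_chart (phi1 : chart R n1 M1) (phi2 : chart R n2 M2) :
    chart R (n1 + n2) (M1 * M2)%type :=
  Chart (cdom phi1 `*` cdom phi2)
        (fun p => row_mx (cmap phi1 p.1) (cmap phi2 p.2))
        (fun x => (cinv phi1 (lsubmx x), cinv phi2 (rsubmx x))).

Definition prod_charted (A1 : charted R n1 M1) (A2 : charted R n2 M2) :
    charted R (n1 + n2) (M1 * M2)%type :=
  Charted [set prod_chart phi1 phi2 | phi1 in atlas A1 & phi2 in atlas A2]
          (fun p => prod_chart (chart_at A1 p.1) (chart_at A2 p.2)).

End product.

Section fields.
Context {R : realType} {n : nat} {M : topologicalType}.
Variable A : charted R n M.

Definition vfield := M -> 'rV[R]_n.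
Definition form1 := M -> 'cV[R]_n.
Definition tensor02 := M -> 'M[R]_n.
Definition tensor20 := M -> 'M[R]_n.

Definition coord_at (p : M) : 'rV[R]_n := cmap (chart_at A p) p.

(* A vector u of T_pM has coordinates u *m to_chart phi p in the chart phi. *)
Definition to_chart (phi : chart R n M) (p : M) : 'M[R]_n :=
  'J (cmap phi \o cinv (chart_at A p)) (coord_at p).

(* Row i is the i-th coordinate vector field of phi at p, as a vector of
   T_pM. *)
Definition from_chart (phi : chart R n M) (p : M) : 'M[R]_n :=
  'J (cmap (chart_at A p) \o cinv phi) (cmap phi p).

Definition smooth_fun (f : M -> R) : Prop :=
  forall phi, atlas A phi -> smooth_on (cimg phi) (f \o cinv phi).

(* Smoothness of tensor fields: smoothness of the components in every chart. *)
Definition smooth_form1 (a : form1) : Prop :=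
  forall phi, atlas A phi ->
    smooth_on (cimg phi) ((fun p => from_chart phi p *m a p) \o cinv phi).

Definition smooth02 (g : tensor02) : Prop :=
  forall phi, atlas A phi ->
    smooth_on (cimg phi)
      ((fun p => from_chart phi p *m g p *m (from_chart phi p)^T) \o cinv phi).

Definition smooth20 (h : tensor20) : Prop :=
  forall phi, atlas A phi ->
    smooth_on (cimg phi)
      ((fun p => (to_chart phi p)^T *m h p *m to_chart phi p) \o cinv phi).

Definition eval02 (g : tensor02) (X Y : vfield) (p : M) : R :=
  (X p *m g p *m (Y p)^T) 0 0.

Definition eval20 (h : tensor20) (a b : form1) (p : M) : R :=
  ((a p)^T *m h p *m b p) 0 0.

Definition vtensor (X Y : vfield) : tensor20 := fun p => (X p)^T *m Y p.
Definition vodot (X Y : vfield) : tensor20 :=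
  fun p => vtensor X Y p + vtensor Y X p.

Definition ftensor (a b : form1) : tensor02 := fun p => a p *m (b p)^T.
Definition fodot (a b : form1) : tensor02 :=
  fun p => ftensor a b p + ftensor b a p.

Definition dfun (f : M -> R) : form1 := fun p =>
  \col_i 'D_(delta_mx 0 i) (f \o cinv (chart_at A p)) (coord_at p).

Definition symmetric02 (g : tensor02) : Prop := forall p, (g p)^T = g p.
Definition nondegenerate02 (g : tensor02) : Prop := forall p, g p \in unitmx.

(* The rows of W span a q-dimensional subspace on which B is negative
   definite. *)
Definition negdef_on (B : 'M[R]_n) (q : nat) (W : 'M[R]_(q, n)) : Prop :=
  row_free W /\
  forall u : 'rV[R]_q, u != 0 -> ((u *m W) *m B *m (u *m W)^T) 0 0 < 0.

Definition has_index (B : 'M[R]_n) (q : nat) : Prop :=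
  (exists W : 'M[R]_(q, n), negdef_on B W) /\
  (forall q' (W : 'M[R]_(q', n)), negdef_on B W -> (q' <= q)%N).

Definition pseudo_riemannian (g : tensor02) : Prop :=
  [/\ smooth02 g, symmetric02 g, nondegenerate02 g &
      exists q, forall p, has_index (g p) q].

(* Only meaningful for a nondegenerate g. *)
Definition cometric (g : tensor02) : tensor20 := fun p => invmx (g p).

(* The solution of g(grad f, .) = df, that is grad f *m g = (df)^T. *)
Definition grad (g : tensor02) (f : M -> R) : vfield :=
  fun p => (dfun f p)^T *m invmx (g p).

Definition grad_sqnorm (g : tensor02) (f : M -> R) : M -> R :=
  eval02 g (grad g f) (grad g f).

End fields.

Section pullback.
Context {R : realType} {m n : nat} {M N : topologicalType}.
Variables (A : charted R m M) (B : charted R n N).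

Definition tangent_map (F : M -> N) (p : M) : 'M[R]_(m, n) :=
  'J (cmap (chart_at B (F p)) \o F \o cinv (chart_at A p)) (coord_at A p).

Definition pullback_form1 (F : M -> N) (a : @form1 R n N) : @form1 R m M :=
  fun p => tangent_map F p *m a (F p).

Definition pullback02 (F : M -> N) (g : @tensor02 R n N) : @tensor02 R m M :=
  fun p => tangent_map F p *m g (F p) *m (tangent_map F p)^T.

End pullback.

Section lifts.
Context {R : realType} {n1 n2 : nat} {M1 M2 : topologicalType}.
Variables (A1 : charted R n1 M1) (A2 : charted R n2 M2).
Let A := prod_charted A1 A2.

Definition dpi1 : M1 * M2 -> 'M[R]_(n1 + n2, n1) := tangent_map A A1 fst.
Definition dpi2 : M1 * M2 -> 'M[R]_(n1 + n2, n2) := tangent_map A A2 snd.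

(* The linear map u |-> u^h from the tangent space of M1 at p.1 to that of
   M1 * M2 at p, determined by dpi1 (u^h) = u and dpi2 (u^h) = 0. *)
Definition hlift_mx (p : M1 * M2) : 'M[R]_(n1, n1 + n2) :=
  get [set L : 'M[R]_(n1, n1 + n2) | L *m dpi1 p = 1%:M /\ L *m dpi2 p = 0].

Definition vlift_mx (p : M1 * M2) : 'M[R]_(n2, n1 + n2) :=
  get [set L : 'M[R]_(n2, n1 + n2) | L *m dpi1 p = 0 /\ L *m dpi2 p = 1%:M].

Definition hlift_vf (X : @vfield R n1 M1) :
    @vfield R (n1 + n2) (M1 * M2)%type :=
  fun p => X p.1 *m hlift_mx p.
Definition vlift_vf (X : @vfield R n2 M2) :
    @vfield R (n1 + n2) (M1 * M2)%type :=
  fun p => X p.2 *m vlift_mx p.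

Definition hlift20 (h : @tensor20 R n1 M1) :
    @tensor20 R (n1 + n2) (M1 * M2)%type :=
  fun p => (hlift_mx p)^T *m h p.1 *m hlift_mx p.
Definition vlift20 (h : @tensor20 R n2 M2) :
    @tensor20 R (n1 + n2) (M1 * M2)%type :=
  fun p => (vlift_mx p)^T *m h p.2 *m vlift_mx p.

Definition hlift_fun (f : M1 -> R) : M1 * M2 -> R := f \o fst.
Definition vlift_fun (f : M2 -> R) : M1 * M2 -> R := f \o snd.

Definition hlift_form1 (a : @form1 R n1 M1) :
    @form1 R (n1 + n2) (M1 * M2)%type := pullback_form1 A A1 fst a.
Definition vlift_form1 (a : @form1 R n2 M2) :
    @form1 R (n1 + n2) (M1 * M2)%type := pullback_form1 A A2 snd a.

Definition product_metric (c : R) (g1 : @tensor02 R n1 M1)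
    (g2 : @tensor02 R n2 M2) (f1 : M1 -> R) (f2 : M2 -> R) :
    @tensor02 R (n1 + n2) (M1 * M2)%type := fun p =>
  (vlift_fun f2 p) ^+ 2 *: pullback02 A A1 fst g1 p
  + (hlift_fun f1 p) ^+ 2 *: pullback02 A A2 snd g2 p
  + (c * hlift_fun f1 p * vlift_fun f2 p) *:
      fodot (hlift_form1 (dfun A1 f1)) (vlift_form1 (dfun A2 f2)) p.

End lifts.

Lemma grad_spec (R : realType) (n : nat) (M : topologicalType)
    (A : charted R n M) (g : @tensor02 R n M) (f : M -> R) (X : @vfield R n M) :
  nondegenerate02 g ->
  forall p, eval02 g (grad A g f) X p = (X p *m dfun A f p) 0 0.
Proof.
move=> gU p; rewrite /eval02 /grad mulmxKV// -trmx_mul mxE //.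
Qed.

Lemma cometric_spec (R : realType) (n : nat) (M : topologicalType)
    (g : @tensor02 R n M) (X Y : @vfield R n M) :
  symmetric02 g -> nondegenerate02 g ->
  forall p, eval20 (cometric g) (fun q => g q *m (X q)^T)
                   (fun q => g q *m (Y q)^T) p = eval02 g X Y p.
Proof.
by move=> gS gU p; rewrite /eval20 /eval02 /cometric trmx_mul trmxK gS !mulmxA mulmxK.
Qed.

Lemma near_linear_jacobian (R : realType) (m n : nat)
    (L : {linear 'rV[R]_m -> 'rV[R]_n}) (f : 'rV[R]_m -> 'rV[R]_n) x :
  continuous L -> (\forall y \near x, f y = L y) -> 'J f x = lin1_mx L.
Proof.
move=> cL fL; rewrite /jacobian.
suff dfL : 'd f x = L :> (_ -> _) by apply/matrixP => i j; rewrite !mxE dfL.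
apply: diff_unique => //; apply/eqaddoP => _/posnumP[e].
have fL0 : \forall h \near (0 : 'rV[R]_m), f (h + x) = L (h + x).
  have := fL; rewrite (near_shift 0) subr0; apply: filterS => h.
  by [].
near=> h.
have -> : (f \o shift x - (cst (f x) + L)) h = f (h + x) - (f x + L h) by [].
rewrite (near fL0 h) // (nbhs_singleton fL) linearD [L h + _]addrC subrr normr0.
exact: mulr_ge0.
Unshelve. all: by end_near. Qed.

(* Existence and uniqueness of the lifts: the tangent space of the product at p
   is the direct sum of those of the factors. *)
Section dpi.
Context {R : realType} {n1 n2 : nat} {M1 M2 : topologicalType}.
Variables (A1 : charted R n1 M1) (A2 : charted R n2 M2).
Hypotheses (hA1 : smooth_manifold A1) (hA2 : smooth_manifold A2).

Lemma chart_at_near (n : nat) (M : topologicalType) (A : charted R n M) p :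
  smooth_manifold A ->
  \forall y \near coord_at A p, cmap (chart_at A p) (cinv (chart_at A p) y) = y.
Proof.
case=> _ _ hc /(_ p)[/hc[_ oI K _ _] dp] _.
have : nbhs (coord_at A p) (cimg (chart_at A p)).
  by apply: open_nbhs_nbhs; split => //; exists p.
by apply: filterS => _ [q dq <-]; rewrite K.
Qed.


Lemma dpi1E p : dpi1 A1 A2 p = col_mx 1%:M 0.
Proof.
have -> : col_mx 1%:M 0 = lin1_mx (lsubmx : 'rV[R]_(n1 + n2) -> 'rV[R]_n1).
  apply/matrixP => i j; rewrite !mxE; case: splitP => k ik; rewrite !mxE /= -[in RHS]val_eqE /= ik /=.
    by rewrite eq_sym.
  by rewrite ltn_eqF// ltn_addr.
apply: near_linear_jacobian; first exact: continuous_lsubmx.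
have := @continuous_lsubmx R 1 n1 n2 (row_mx (coord_at A1 p.1) (coord_at A2 p.2)).
rewrite /continuous_at row_mxKl => /(_ _ (chart_at_near p.1 hA1)).
by [].
Qed.

Lemma dpi2E p : dpi2 A1 A2 p = col_mx 0 1%:M.
Proof.
have -> : col_mx 0 1%:M = lin1_mx (rsubmx : 'rV[R]_(n1 + n2) -> 'rV[R]_n2).
  apply/matrixP => i j; rewrite !mxE; case: splitP => k ik; rewrite !mxE /= -[in RHS]val_eqE /= ik /=.
    by rewrite gtn_eqF// ltn_addr.
  by rewrite eqn_add2l eq_sym.
apply: near_linear_jacobian; first exact: continuous_rsubmx.
have := @continuous_rsubmx R 1 n1 n2 (row_mx (coord_at A1 p.1) (coord_at A2 p.2)).
rewrite /continuous_at row_mxKr => /(_ _ (chart_at_near p.2 hA2)).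
by [].
Qed.

Lemma hlift_mxE p : hlift_mx A1 A2 p = row_mx 1%:M 0.
Proof.
rewrite /hlift_mx; set S := [set L | _].
have [] : S (get S).
  apply: (@getI _ S (row_mx 1%:M 0)).
  by rewrite /S /= dpi1E dpi2E !mul_row_col !mulmx1 !mulmx0 !addr0.
rewrite dpi1E dpi2E -[get S]hsubmxK !mul_row_col !mulmx1 !mulmx0 addr0 add0r.
by move=> -> ->.
Qed.

Lemma vlift_mxE p : vlift_mx A1 A2 p = row_mx 0 1%:M.
Proof.
rewrite /vlift_mx; set S := [set L | _].
have [] : S (get S).
  apply: (@getI _ S (row_mx 0 1%:M)).
  by rewrite /S /= dpi1E dpi2E !mul_row_col !mulmx1 !mulmx0 !add0r.
rewrite dpi1E dpi2E -[get S]hsubmxK !mul_row_col !mulmx1 !mulmx0 addr0 add0r.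
by move=> -> ->.
Qed.
End dpi.

(* Main.v *)
Require Import Defs.
From HB Require Import structures.
From mathcomp Require Import all_boot all_order all_algebra.
From mathcomp Require Import all_classical all_reals all_analysis.
From mathcomp Require Import ring.
Import Order.TTheory GRing.Theory Num.Theory.
Import numFieldNormedType.Exports.
Local Open Scope classical_set_scope.
Local Open Scope ring_scope.

(** Writing d_i for df_i and v_i for the row grad f_i, the matrix of G in the
    tangent space splits into blocks f2^2 g1, c f1 f2 d1 d2^T, its transpose and
    f1^2 g2; since g_i v_i^T = d_i and v_i d_i = b_i, multiplying by the announced
    matrix gives the identity, the off-diagonal cancellation being
    D - 1 + c^2 b1 b2 = 0 with D = 1 - c^2 b1 b2.

    Uniqueness needs enough global smooth 1-forms: a covector at p extends to the
    form that is constant in a chart at p, cut off by a bump function built from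
    exp(-1/t), whose support is compact, hence closed in the Hausdorff space M.

    Smoothness of the cometric is read off the same blocks in product charts,
    where to_chart is block diagonal. *)

Set Implicit Arguments.
Unset Strict Implicit.
Unset Printing Implicit Defensive.

(** * Smooth functions on open sets *)

(** The first-order expansion of [f] at [x] is also one of [g], since values and nearby increments
    agree; [diff_unique] then identifies the two differentials. *)
Lemma near_eq_differentiable (R : realType) (V W : normedModType R)
    (f g : V -> W) x :
  {near x, f =1 g} -> differentiable f x -> differentiable g x.
Proof.
move=> fg /diff_locallyP[dfc fE].
suff gE : g \o shift x = cst (g x) + 'd f x +o_ (0 : V) id.
  by apply/diff_locallyP; rewrite (diff_unique dfc gE).
have fg0 : \forall h \near (0 : V), f (h + x) = g (h + x).
  by have := fg; rewrite (near_shift 0) subr0.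
apply/eqaddoP => e e0; move/eqaddoP : fE => /(_ _ e0) fe.
near=> h.
have -> : (g \o shift x - (cst (g x) + 'd f x)) h =
          (f \o shift x - (cst (f x) + 'd f x)) h.
  rewrite -[LHS]/(g (h + x) - (g x + _)) -[RHS]/(f (h + x) - (f x + _)).
  by rewrite (near fg0 h) // (nbhs_singleton fg).
by near: h.
Unshelve. all: by end_near. Qed.

Section smooth_calculus.
Context {R : realType} {m : nat}.
Implicit Type U V : set 'rV[R]_m.

Lemma Ck0P {W : normedModType R} U (f : 'rV[R]_m -> W) :
  open U -> Ck 0 U f <-> {in U, continuous f}.
Proof. by move=> oU; rewrite -(continuous_open_subspace _ oU); split. Qed.

(** The recursive definition asks at order [k.+1] for differentiability and for [Ck k] derivatives,
    not for [Ck k] itself; at order 0 the gap is closed by continuity of differentiable maps. *)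
Lemma CkW {W : normedModType R} U k (f : 'rV[R]_m -> W) :
  open U -> Ck k.+1 U f -> Ck k U f.
Proof.
move=> oU; elim: k f => [|k IH] f [df Df].
  by apply/Ck0P => // x /set_mem Ux; exact/differentiable_continuous/df.
by split=> // v; exact/IH/Df.
Qed.

Lemma Ck_local {W : normedModType R} U k (f : 'rV[R]_m -> W) : open U ->
  (forall x, U x -> exists V, [/\ open V, V x & Ck k V f]) -> Ck k U f.
Proof.
move=> oU; elim: k f => [|k IH] f fV.
  apply/Ck0P => // x /set_mem /fV[V [oV Vx]] /(Ck0P _ oV); apply.
  exact/mem_set.
split=> [x /fV[V [oV Vx [df _]]]|v]; first exact: df.
by apply: IH => x /fV[V [oV Vx [_ Df]]]; exists V; split => //; exact: Df.
Qed.

(** As [U] is open, equality on [U] is equality near each of its points, which is all that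
    derivatives see. *)
Lemma eq_Ck {W : normedModType R} U k (f g : 'rV[R]_m -> W) : open U ->
  (forall x, U x -> f x = g x) -> Ck k U f -> Ck k U g.
Proof.
move=> oU; elim: k f g => [|k IH] f g fg.
  move=> fc; apply: subspace_eq_continuous fc => x /set_mem; exact: fg.
have fgx x : U x -> {near x, f =1 g}.
  by move=> Ux; near=> y; apply: fg; near: y; exact: open_nbhs_nbhs.
move=> [df Df]; split=> [x Ux|v].
  exact: near_eq_differentiable (fgx _ Ux) (df _ Ux).
by apply: (IH _ _ _ (Df v)) => x Ux; apply: near_eq_derive; exact: fgx.
Unshelve. all: by end_near. Qed.

Lemma eq_smooth_on {W : normedModType R} U (f g : 'rV[R]_m -> W) : open U ->
  (forall x, U x -> f x = g x) -> smooth_on U f -> smooth_on U g.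
Proof. by move=> oU fg fs k; apply: eq_Ck (fs k). Qed.

Lemma eq_fun_smooth {W : normedModType R} U (f g : 'rV[R]_m -> W) :
  f =1 g -> smooth_on U g -> smooth_on U f.
Proof. by move=> /funext->. Qed.

Lemma smooth_on_local {W : normedModType R} U (f : 'rV[R]_m -> W) : open U ->
  (forall x, U x -> exists V, [/\ open V, V x & smooth_on V f]) ->
  smooth_on U f.
Proof.
move=> oU fV k; apply: Ck_local => // x /fV[V [oV Vx fs]].
by exists V; split.
Qed.

Lemma smooth_on_subset {W : normedModType R} U V (f : 'rV[R]_m -> W) :
  V `<=` U -> smooth_on U f -> smooth_on V f.
Proof.
move=> VU fs k; elim: k f {fs}(fs k) => [f|k IH f [df Df]].
  exact: continuous_subspaceW.
by split=> [x /VU/df//|v]; apply: IH (Df v).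
Qed.

Lemma smooth_differentiable {W : normedModType R} U (f : 'rV[R]_m -> W) x :
  smooth_on U f -> U x -> differentiable f x.
Proof. by move=> /(_ 1)[/= df _]; exact: df. Qed.

Lemma smooth_derive {W : normedModType R} U (f : 'rV[R]_m -> W) v :
  smooth_on U f -> smooth_on U (fun x => 'D_v f x).
Proof. by move=> fs k; have [_] := fs k.+1; exact. Qed.

Lemma Ck_cst {W : normedModType R} U k (a : W) : Ck k U (fun=> a).
Proof.
elim: k a => [|k IH] a.
  by apply: continuous_subspaceT => x; exact: cst_continuous.
split=> [x _|v]; first exact: differentiable_cst.
have -> : (fun x => 'D_v (fun=> a) x) = (fun=> 0) :> ('rV[R]_m -> W).
  by apply/funext => x; exact: derive_cst.
exact: IH.
Qed.

Lemma smooth_cst {W : normedModType R} U (a : W) : smooth_on U (fun=> a).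
Proof. by move=> k; exact: Ck_cst. Qed.

Lemma CkD {W : normedModType R} U k (f g : 'rV[R]_m -> W) : open U ->
  Ck k U f -> Ck k U g -> Ck k U (fun x => f x + g x).
Proof.
move=> oU; elim: k f g => [f g|k IH f g [df Df] [dg Dg]].
  move=> /(Ck0P _ oU) cf /(Ck0P _ oU) cg; apply/Ck0P => // x Ux.
  by apply: continuousD; [exact: cf|exact: cg].
split=> [x Ux|v]; first exact: differentiableD (df _ Ux) (dg _ Ux).
apply: eq_Ck (IH _ _ (Df v) (Dg v)) => // x Ux; apply/esym.
by apply: deriveD; apply: diff_derivable; [exact: df|exact: dg].
Qed.

Lemma smooth_id U : smooth_on U (fun x : 'rV[R]_m => x).
Proof.
case=> [|k]; first by apply: continuous_subspaceT => x; exact: cvg_id.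
split=> [x _|v]; first by have [] := is_diff_id x.
have -> : (fun x => 'D_v (fun y : 'rV[R]_m => y) x) = (fun=> v).
  by apply/funext => x; exact: derive_id.
exact: Ck_cst.
Qed.

Lemma smoothD {W : normedModType R} U (f g : 'rV[R]_m -> W) : open U ->
  smooth_on U f -> smooth_on U g -> smooth_on U (fun x => f x + g x).
Proof. by move=> oU fs gs k; exact: CkD. Qed.

Lemma Ck_sum {W : normedModType R} U k I (r : seq I) (P : pred I)
    (F : I -> 'rV[R]_m -> W) : open U -> (forall i, P i -> Ck k U (F i)) ->
  Ck k U (fun x => \sum_(i <- r | P i) F i x).
Proof.
move=> oU Fs; elim: r => [|i r IH].
  by apply: eq_Ck (Ck_cst U k 0) => // x _; rewrite big_nil.
case: (boolP (P i)) => Pi; last first.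
  by apply: eq_Ck IH => // x _; rewrite big_cons (negPf Pi).
by apply: eq_Ck (CkD oU (Fs _ Pi) IH) => // x _; rewrite big_cons Pi.
Qed.

Lemma smooth_sum {W : normedModType R} U I (r : seq I) (P : pred I)
    (F : I -> 'rV[R]_m -> W) : open U ->
  (forall i, P i -> smooth_on U (F i)) ->
  smooth_on U (fun x => \sum_(i <- r | P i) F i x).
Proof. by move=> oU Fs k; apply: Ck_sum => // i /Fs. Qed.

Implicit Types (f g : 'rV[R]_m -> R).

(** The product rule multiplies each derivative, of class [Ck k], by the other factor itself, which
    must first be lowered from order [k.+1] to [k]. *)
Lemma CkM U k f g : open U -> Ck k U f -> Ck k U g ->
  Ck k U (fun x => f x * g x).
Proof.
move=> oU; elim: k f g => [f g|k IH f g fC gC].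
  move=> /(Ck0P _ oU) cf /(Ck0P _ oU) cg; apply/Ck0P => // x Ux.
  by apply: continuousM; [exact: cf|exact: cg].
have [df Df] := fC; have [dg Dg] := gC.
split=> [x Ux|v]; first exact: differentiableM (df _ Ux) (dg _ Ux).
have := CkD oU (IH _ _ (CkW oU fC) (Dg v)) (IH _ _ (CkW oU gC) (Df v)).
apply: eq_Ck => // x Ux.
by apply/esym; apply: deriveM; apply: diff_derivable; [exact: df|exact: dg].
Qed.

Lemma smoothM U f g : open U -> smooth_on U f -> smooth_on U g ->
  smooth_on U (fun x => f x * g x).
Proof. by move=> oU fs gs k; exact: CkM. Qed.

Lemma smooth_prod U I (r : seq I) (P : pred I) (F : I -> 'rV[R]_m -> R) :
  open U -> (forall i, P i -> smooth_on U (F i)) ->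
  smooth_on U (fun x => \prod_(i <- r | P i) F i x).
Proof.
move=> oU Fs; elim: r => [|i r IH].
  apply: eq_fun_smooth => [x|]; first by rewrite big_nil.
  exact: smooth_cst.
case: (boolP (P i)) => Pi; last first.
  by apply: eq_fun_smooth IH => x; rewrite big_cons (negPf Pi).
apply: eq_fun_smooth => [x|]; first by rewrite big_cons Pi.
by apply: smoothM => //; exact: Fs.
Qed.

Lemma smoothX U f n : open U -> smooth_on U f ->
  smooth_on U (fun x => f x ^+ n).
Proof.
move=> oU fs; elim: n => [|n IH]; first exact: smooth_cst.
apply: eq_fun_smooth => [x|]; first by rewrite exprS.
  exact: smoothM.
Qed.

Lemma CkV U k f : open U -> (forall x, U x -> f x != 0) -> Ck k U f ->
  Ck k U (fun x => (f x)^-1).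
Proof.
move=> oU f0; elim: k => [|k IH] fC.
  move/(Ck0P _ oU) : fC => cf; apply/Ck0P => // x Ux.
  by apply: continuousV; [exact/f0/set_mem|exact: cf].
have [df Df] := fC; have iC := IH (CkW oU fC).
split=> [x Ux|v]; first exact: differentiableV (df _ Ux) (f0 _ Ux).
(* The derivative of 1/f is -(1/f)(1/f) Df, where 1/f is of class [Ck k] by induction. *)
have := CkM oU (Ck_cst U k (- 1 : R)) (CkM oU (CkM oU iC iC) (Df v)).
apply: eq_Ck => // x Ux.
rewrite deriveV//; last exact/diff_derivable/df.
  by rewrite mulN1r -expr2 exprVn -[RHS]/(_ * _) mulNr.
exact: f0.
Qed.

Lemma smoothV U f : open U -> (forall x, U x -> f x != 0) -> smooth_on U f ->
  smooth_on U (fun x => (f x)^-1).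
Proof. by move=> oU f0 fs k; exact: CkV. Qed.

(** Taking an entry is linear and commutes with derivation; conversely a matrix is the finite sum of
    its entries times the elementary matrices. *)
Lemma smooth_mxP U a b (F : 'rV[R]_m -> 'M[R]_(a, b)) : open U ->
  smooth_on U F <-> forall i j, smooth_on U (fun x => F x i j).
Proof.
move=> oU; split=> [Fs i j k|Fs k].
  elim: k F {Fs}(Fs k) => [F|k IH F [dF DF]].
    move=> /(Ck0P _ oU) cF; apply/Ck0P => // x Ux.
    apply: (@continuous_comp _ _ _ F (fun M : 'M[R]_(a, b) => M i j)).
      exact: cF.
    exact: coord_continuous.
  split=> [x Ux|v].
    exact: (@differentiable_comp _ _ _ _ F (fun M : 'M[R]_(a, b) => M i j) _
              (dF _ Ux) (differentiable_coord _ i j)).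
  apply: eq_Ck (IH _ (DF v)) => // x Ux; rewrite derive_mx ?mxE//.
  exact/diff_derivable/dF.
have : forall i j, Ck k U (fun x => F x i j) by move=> i j; exact: Fs.
elim: k F {Fs} => [|k IH] F Fs.
  have -> : F = (fun x => \sum_i \sum_j F x i j *: delta_mx i j).
    by apply/funext => y; exact: matrix_sum_delta.
  apply: Ck_sum => // i _; apply: Ck_sum => // j _.
  apply/Ck0P => // x Ux; apply: continuousZr_tmp.
  by have /(Ck0P _ oU) := Fs i j; exact.
have dF x : U x -> differentiable F x.
  move=> Ux.
  have -> : F = \sum_i \sum_j (fun x => F x i j *: delta_mx i j).
    apply/funext => y; rewrite fct_sumE [LHS]matrix_sum_delta.
    by apply: eq_bigr => i _; rewrite fct_sumE.
  apply: differentiable_sum => i; apply: differentiable_sum => j.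
  by apply: differentiableZl; have [df _] := Fs i j; exact: df.
split=> // v; apply: IH => i j; have [_ /(_ v)] := Fs i j.
apply: eq_Ck => // x Ux; rewrite derive_mx ?mxE//.
exact/diff_derivable/dF.
Qed.

(** * Matrix operations on smooth maps *)

Section matrix_valued.
Variables (U : set 'rV[R]_m) (oU : open U).

Lemma smooth_mulmx a b c (F : 'rV[R]_m -> 'M[R]_(a, b))
    (G : 'rV[R]_m -> 'M[R]_(b, c)) :
  smooth_on U F -> smooth_on U G -> smooth_on U (fun x => F x *m G x).
Proof.
move=> /(smooth_mxP _ oU) Fs /(smooth_mxP _ oU) Gs; apply/smooth_mxP => // i j.
apply: eq_fun_smooth => [x|]; first by rewrite mxE.
by apply: smooth_sum => // k _; exact: smoothM.
Qed.

Lemma smooth_scalemx a b (f : 'rV[R]_m -> R) (F : 'rV[R]_m -> 'M[R]_(a, b)) :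
  smooth_on U f -> smooth_on U F -> smooth_on U (fun x => f x *: F x).
Proof.
move=> fs /(smooth_mxP _ oU) Fs; apply/smooth_mxP => // i j.
apply: eq_fun_smooth => [x|]; first by rewrite mxE.
  exact: smoothM.
Qed.

Lemma smooth_trmx a b (F : 'rV[R]_m -> 'M[R]_(a, b)) :
  smooth_on U F -> smooth_on U (fun x => (F x)^T).
Proof.
move=> /(smooth_mxP _ oU) Fs; apply/smooth_mxP => // i j.
apply: eq_fun_smooth => [x|]; first by rewrite mxE.
  exact: Fs.
Qed.

Lemma smooth_det a (F : 'rV[R]_m -> 'M[R]_a) :
  smooth_on U F -> smooth_on U (fun x => \det (F x)).
Proof.
move=> /(smooth_mxP _ oU) Fs; apply: smooth_sum => // s _.
apply: smoothM => //; first exact: smooth_cst.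
by apply: smooth_prod => // i _; exact: Fs.
Qed.

(** By the adjugate formula, whose entries are polynomials in those of [F], divided by a determinant
    that does not vanish on [U]. *)
Lemma smooth_invmx a (F : 'rV[R]_m -> 'M[R]_a) :
  (forall x, U x -> F x \in unitmx) ->
  smooth_on U F -> smooth_on U (fun x => invmx (F x)).
Proof.
move=> FU Fs.
apply: (@eq_smooth_on _ _ (fun x => (\det (F x))^-1 *: \adj (F x))) => //.
  by move=> x /FU Fx; rewrite /invmx Fx.
apply: smooth_scalemx.
  apply: smoothV => //; last exact: smooth_det.
  by move=> x /FU; rewrite unitmxE unitfE.
apply/smooth_mxP => // i j.
apply: eq_fun_smooth => [x|]; first by rewrite mxE /cofactor.
apply: smoothM => //; first exact: smooth_cst.
apply: smooth_det; apply/smooth_mxP => // k l.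
apply: eq_fun_smooth => [x|]; first by rewrite !mxE.
  exact: (smooth_mxP _ _).1.
Qed.

Lemma smooth_block_mx a b c d
    (F : 'rV[R]_m -> 'M[R]_(a, c)) (G : 'rV[R]_m -> 'M[R]_(a, d))
    (H : 'rV[R]_m -> 'M[R]_(b, c)) (K : 'rV[R]_m -> 'M[R]_(b, d)) :
  smooth_on U F -> smooth_on U G -> smooth_on U H -> smooth_on U K ->
  smooth_on U (fun x => block_mx (F x) (G x) (H x) (K x)).
Proof.
move=> /(smooth_mxP _ oU) Fs /(smooth_mxP _ oU) Gs.
move=> /(smooth_mxP _ oU) Hs /(smooth_mxP _ oU) Ks; apply/smooth_mxP => // i j.
rewrite -[i]fintype.splitK -[j]fintype.splitK.
case: (fintype.split i) => i'; case: (fintype.split j) => j' /=;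
  apply: eq_fun_smooth => [x|].
- by rewrite block_mxEul.
- exact: Fs.
- by rewrite block_mxEur.
- exact: Gs.
- by rewrite block_mxEdl.
- exact: Hs.
- by rewrite block_mxEdr.
- exact: Ks.
Qed.

End matrix_valued.

End smooth_calculus.

(** The derivative of [f \o L] along [v] is the derivative of [f] along [L v], composed with [L]:
    again of the same shape, so the induction on the order closes without products. *)
Lemma smooth_comp_linear (R : realType) (m n : nat) (W : normedModType R)
    (L : {linear 'rV[R]_m -> 'rV[R]_n}) (U : set 'rV[R]_n)
    (f : 'rV[R]_n -> W) :
  continuous L -> open U -> smooth_on U f -> smooth_on (L @^-1` U) (f \o L).
Proof.
move=> cL oU fs k; have oLU : open (L @^-1` U) by apply: open_comp.
elim: k f {fs}(fs k) => [f /(Ck0P _ oU) cf|k IH f [df Df]].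
  apply/Ck0P => // x /set_mem Ux; apply: continuous_comp; first exact: cL.
  exact/cf/mem_set.
have dL x : differentiable L x by exact: linear_differentiable.
split=> [x Ux|v]; first exact/differentiable_comp/df.
apply: eq_Ck (IH _ (Df (L v))) => // x Ux /=.
have dfLx : differentiable f (L x) by exact: df.
have dfL : differentiable (f \o L) x by exact: differentiable_comp.
rewrite (deriveE _ dfLx) (deriveE _ dfL).
have -> : 'd (f \o L) x = 'd f (L x) \o 'd L x :> (_ -> _) by exact: diff_comp.
by have /= -> : 'd L x = L :> (_ -> _) by exact: diff_lin.
Qed.

(** * Bump functions *)

Section flat.
Context {R : realType}.
Implicit Type t : R.

(* The index n makes the family closed under differentiation, so that smoothness
   is an induction on the order. *)
Definition flat n t : R := if 0 < t then expR (- t^-1) * t^-1 ^+ n else 0.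

Lemma flat_gt0 n t : 0 < t -> 0 < flat n t.
Proof. by move=> t0; rewrite /flat t0 mulr_gt0 ?expR_gt0 ?exprn_gt0 ?invr_gt0. Qed.

Lemma flat_le0 n t : t <= 0 -> flat n t = 0.
Proof. by rewrite /flat ltNge => ->. Qed.

(** For positive t, exp(1/t) dominates its Taylor term of order n+2. The two spare powers of t make
    the difference quotient of [flat n] at 0 tend to 0. *)
Lemma flat_bound n t : `|flat n t| <= n.+2`!%:R * t ^+ 2.
Proof.
rewrite /flat; case: ifPn => [t0|_]; last first.
  by rewrite normr0 mulr_ge0// sqr_ge0.
have s0 : 0 < t^-1 by rewrite invr_gt0.
rewrite ger0_norm; last by rewrite mulr_ge0 ?expR_ge0 ?exprn_ge0 ?(ltW s0).
have : t^-1 ^+ n.+2 / n.+2`!%:R <= expR t^-1.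
  by apply: le_trans (expR_ge1Dxn n.+1 (ltW s0)); rewrite lerDr.
rewrite ler_pdivrMr ?ltr0n ?fact_gt0// => le_exp.
have -> : t^-1 ^+ n = t^-1 ^+ n.+2 * t ^+ 2.
  by rewrite -addn2 exprD -mulrA -exprMn mulVf ?gt_eqF// expr1n mulr1.
rewrite mulrA ler_wpM2r ?sqr_ge0// expRN mulrC ler_pdivrMr ?expR_gt0//.
by rewrite mulrC.
Qed.

Lemma is_derive_flat n t :
  is_derive t 1 (flat n) (flat n.+2 t - n%:R * flat n.+1 t).
Proof.
have [t0|t0|->] := ltrgtP t 0.
- rewrite !(flat_le0 _ (ltW t0)) mulr0 subr0.
  have := is_derive_cst (0 : R) t 1; apply: near_eq_is_derive.
  by near=> y; rewrite flat_le0// ltW//; near: y; exact: lt_nbhsl.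
- apply: (@near_eq_is_derive _ _ _
    ((expR \o (fun y => - y^-1)) * (fun y => y^-1) ^+ n)).
    by near=> y; rewrite /flat ifT ?exprfctE//; near: y; exact: lt_nbhsr.
  have dV : is_derive t 1 (fun y => y^-1) (- t ^- 2).
    apply: is_derive_eq; first by apply: is_deriveV; rewrite ?gt_eqF.
    by rewrite scaler1.
  have dE := @is_derive1_comp _ expR (- GRing.inv) t _ _
    (is_derive_expR (- t^-1)) (is_deriveN dV).
  have tn : t != 0 by rewrite gt_eqF.
  have dM := is_deriveM dE (is_deriveX n dV).
  rewrite /flat t0; apply: is_derive_eq.
  rewrite exprfctE /= /GRing.scale /= opprK -exprVn.
  by case: n {dM} => [|n] /=; rewrite !exprS; ring.
- have f0 m : flat m 0 = 0 by rewrite flat_le0.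
  rewrite !f0 mulr0 subr0.
  have lim0 : (fun h => h^-1 *: (flat n (h *: 1 + 0) - flat n 0)) @ 0^' --> (0 : R).
    apply/cvgr0Pnorm_le => e e0; near=> h.
    rewrite addr0 f0 subr0 [h *: 1]mulr1 normrM.
    have hn : h != 0 by near: h; exact: nbhs_dnbhs_neq.
    have F0 : 0 < n.+2`!%:R :> R by rewrite ltr0n fact_gt0.
    (* The quotient is at most (n+2)! |h|, so it suffices that |h| be at most e / (n+2)!. *)
    apply: (@le_trans _ _ (`|h|^-1 * (n.+2`!%:R * h ^+ 2))).
      by rewrite normfV ler_wpM2l ?invr_ge0// flat_bound.
    rewrite -normr_id -real_normK ?num_real// normr_id mulrCA expr2 mulKf ?normr_eq0//.
    rewrite mulrC -ler_pdivlMr//.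
    by near: h; apply: dnbhs0_le; rewrite divr_gt0.
  by apply: DeriveDef; [apply/cvg_ex; exists 0|exact: cvg_lim].
Unshelve. all: by end_near. Qed.

Lemma differentiable_flat n t : differentiable (flat n) t.
Proof. by apply/derivable1_diffP; have [] := is_derive_flat n t. Qed.

Lemma Ck_flat m (U : set 'rV[R]_m) k n (u : 'rV[R]_m -> R) :
  open U -> Ck k U u -> Ck k U (fun x => flat n (u x)).
Proof.
move=> oU; elim: k n => [|k IH] n uC.
  move/(Ck0P _ oU) : uC => cu; apply/Ck0P => // x Ux.
  apply: (@continuous_comp _ _ _ u (flat n)); first exact: cu.
  exact/differentiable_continuous/differentiable_flat.
have [du Du] := uC; have uk := CkW oU uC.
split=> [x Ux|v].
  exact: (@differentiable_comp _ _ _ _ u (flat n) _ (du _ Ux)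
            (differentiable_flat _ _)).
have := CkM oU (CkD oU (IH n.+2 uk)
  (CkM oU (Ck_cst U k (- n%:R : R)) (IH n.+1 uk))) (Du v).
apply: eq_Ck => // x Ux.
have dux := du _ Ux; have df := differentiable_flat n (u x).
rewrite (deriveE v (@differentiable_comp _ _ _ _ u (flat n) _ dux df)).
have -> : 'd (fun y => flat n (u y)) x = 'd (flat n) (u x) \o 'd u x
    :> (_ -> R) by exact: diff_comp.
rewrite (deriveE v dux) /= diff1E// /GRing.scale /= mulrC.
by have [_] := is_derive_flat n (u x); rewrite derive1E => ->; rewrite mulNr.
Qed.

Lemma smooth_flat m (U : set 'rV[R]_m) n (u : 'rV[R]_m -> R) :
  open U -> smooth_on U u -> smooth_on U (fun x => flat n (u x)).
Proof. by move=> oU us k; exact: Ck_flat. Qed.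

End flat.

Section cutoff.
Context {R : realType} {m : nat}.
Implicit Types (a : 'rV[R]_m) (r : R).

(** The norm on rows is the sup norm, so for positive [r] a product of one bump per coordinate is
    positive exactly on the open ball of radius [r] about [a]. *)
Definition cutoff a r (x : 'rV[R]_m) : R :=
  \prod_i flat 0 (r ^+ 2 - (x 0 i - a 0 i) ^+ 2).

Lemma cutoff_center a r : 0 < r -> 0 < cutoff a r a.
Proof.
move=> r0; apply: prodr_gt0 => i _; apply: flat_gt0.
by rewrite subrr expr0n subr0 exprn_gt0.
Qed.

(** Some coordinate of [x - a] attains the sup norm, and its factor vanishes. *)
Lemma cutoff_out a r (x : 'rV[R]_m) : 0 < r -> r <= `|x - a| -> cutoff a r x = 0.
Proof.
move=> r0 rx.
have [|[i j] /= xE] := @mx_norm_neq0 R 1 m (x - a).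
  by rewrite gt_eqF// (lt_le_trans r0 rx).
have {}rx : r <= `|x 0 j - a 0 j|.
  by move: rx; rewrite [leRHS]xE (ord1 i) !mxE.
rewrite /cutoff (bigD1 j)//= flat_le0 ?mul0r// subr_le0.
by rewrite -[leRHS]real_normK ?num_real// lerXn2r// nnegrE ltW.
Qed.

(** The map [F] is there because a cutoff defined in one chart is read in another through a
    transition map. *)
Lemma smooth_cutoff n (U : set 'rV[R]_n) (F : 'rV[R]_n -> 'rV[R]_m) a r :
  open U -> smooth_on U F -> smooth_on U (fun x => cutoff a r (F x)).
Proof.
move=> oU /(smooth_mxP _ oU) Fs; apply: smooth_prod => // i _.
have us : smooth_on U (fun x => F x 0 i + - a 0 i).
  by apply: smoothD => //; exact: smooth_cst.
have : smooth_on U (fun x => r ^+ 2 + -1 * (F x 0 i + - a 0 i) ^+ 2).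
  apply: smoothD => //; first exact: smooth_cst.
  by apply: smoothM => //; [exact: smooth_cst|exact: smoothX].
by move/(smooth_flat 0 oU); apply: eq_fun_smooth => x; rewrite mulN1r.
Qed.

End cutoff.

(** * Charts and global forms *)

Section jacobian.
Context {R : realType}.

Lemma row_jacobian (m n : nat) (f : 'rV[R]_m -> 'rV[R]_n) x i :
  differentiable f x -> row i ('J f x) = 'D_(delta_mx 0 i) f x.
Proof. by move=> df; rewrite (deriveEjacobian _ df); exact: rowE. Qed.

Lemma jacobian_comp (m n l : nat) (f : 'rV[R]_m -> 'rV[R]_n)
    (g : 'rV[R]_n -> 'rV[R]_l) x :
  differentiable f x -> differentiable g (f x) ->
  'J (g \o f) x = 'J f x *m 'J g (f x).
Proof.
move=> df dg; have dgf : differentiable (g \o f) x by exact: differentiable_comp.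
apply/row_matrixP => i; rewrite row_mul !rowE -!deriveEjacobian//.
rewrite (deriveE _ dgf) (deriveE _ df) (deriveE _ dg).
by have -> : 'd (g \o f) x = 'd g (f x) \o 'd f x :> (_ -> _) by exact: diff_comp.
Qed.

Lemma near_eq_jacobian (m n : nat) (f g : 'rV[R]_m -> 'rV[R]_n) x :
  differentiable f x -> {near x, f =1 g} -> 'J f x = 'J g x.
Proof.
move=> df fg; have dg := near_eq_differentiable fg df.
apply/row_matrixP => i.
apply: etrans (row_jacobian i df) _; apply: etrans (esym (row_jacobian i dg)).
exact: near_eq_derive.
Qed.

Lemma jacobian_id (m : nat) (f : 'rV[R]_m -> 'rV[R]_m) x :
  (\forall y \near x, f y = y) -> 'J f x = 1%:M.
Proof.
move=> fid; have -> : 'J f x = lin1_mx idfun.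
  by apply: near_linear_jacobian => // y; exact: cvg_id.
by apply/matrixP => i j; rewrite !mxE eqxx /= eq_sym.
Qed.

Lemma smooth_jacobian (m n : nat) (U : set 'rV[R]_m) (f : 'rV[R]_m -> 'rV[R]_n) :
  open U -> smooth_on U f -> smooth_on U (fun x => 'J f x).
Proof.
move=> oU fs; apply/smooth_mxP => // i j.
have /(smooth_mxP _ oU)/(_ 0 j) := smooth_derive (delta_mx 0 i) fs.
apply: eq_smooth_on => // x Ux.
rewrite deriveEjacobian; last exact: smooth_differentiable fs Ux.
by rewrite -rowE mxE.
Qed.

(** The coordinate column of a differential: [dfun A f p] is this column in the preferred chart at
    [p]. *)
Definition partials (m : nat) (h : 'rV[R]_m -> R) (x : 'rV[R]_m) : 'cV[R]_m :=
  \col_i 'D_(delta_mx 0 i) h x.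

Lemma deriveE_partials (m : nat) (h : 'rV[R]_m -> R) x v :
  differentiable h x -> 'D_v h x = (v *m partials h x) 0 0.
Proof.
move=> dh; rewrite (deriveE _ dh) [in LHS](row_sum_delta v) linear_sum mxE.
by apply: eq_bigr => i _; rewrite linearZ mxE (deriveE _ dh).
Qed.

Lemma near_eq_partials (m : nat) (h k : 'rV[R]_m -> R) x :
  {near x, h =1 k} -> partials h x = partials k x.
Proof. by move=> hk; apply/colP => i; rewrite !mxE; exact: near_eq_derive. Qed.

Lemma partials_comp (m n : nat) (f : 'rV[R]_m -> 'rV[R]_n)
    (h : 'rV[R]_n -> R) x :
  differentiable f x -> differentiable h (f x) ->
  partials (h \o f) x = 'J f x *m partials h (f x).
Proof.
move=> df dh; have dhf : differentiable (h \o f) x by exact: differentiable_comp.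
apply/colP => i; rewrite mxE (deriveE _ dhf).
have -> : 'd (h \o f) x = 'd h (f x) \o 'd f x :> (_ -> _) by exact: diff_comp.
rewrite /= -(deriveE _ df) -(deriveE _ dh) deriveE_partials// deriveEjacobian//.
by rewrite -mulmxA -rowE mxE.
Qed.

Lemma smooth_partials (m : nat) (U : set 'rV[R]_m) (h : 'rV[R]_m -> R) :
  open U -> smooth_on U h -> smooth_on U (partials h).
Proof.
move=> oU hs; apply/smooth_mxP => // i j.
have := smooth_derive (delta_mx 0 i) hs.
by apply: eq_smooth_on => // x _; rewrite mxE.
Qed.

End jacobian.

Lemma bilinear_mx_inj (R : comNzRingType) (m n : nat) (B C : 'M[R]_(m, n)) :
  (forall (a : 'cV_m) (b : 'cV_n),
     (a^T *m B *m b) 0 0 = (a^T *m C *m b) 0 0) -> B = C.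
Proof.
move=> BC; apply/matrixP => i j.
have := BC (delta_mx i 0) (delta_mx j 0).
by rewrite !trmx_delta -!rowE -!colE !mxE.
Qed.

(** A change of frame acting on a form by [P] acts on the inverse form by the inverse [Q]. With
    [from_chart] and [to_chart] in these roles, it carries smoothness of a metric over to its
    cometric. *)
Lemma invmx_congruence (R : comUnitRingType) (n : nat) (P Q g : 'M[R]_n) :
  P *m Q = 1%:M -> g \in unitmx ->
  P *m g *m P^T \in unitmx /\ invmx (P *m g *m P^T) = Q^T *m invmx g *m Q.
Proof.
move=> PQ gU; have [PU _] := mulmx1_unit PQ; have QP := mulmx1C PQ.
have KU : P *m g *m P^T \in unitmx by rewrite !unitmx_mul unitmx_tr PU gU.
split=> //; apply: (can_inj (mulKmx KU)); rewrite mulmxV// !mulmxA.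
rewrite -[P *m g *m _ *m _]mulmxA -trmx_mul QP trmx1 mulmx1.
by rewrite mulmxK.
Qed.

(** * Changes of charts, smoothness of gradient and cometric, extension of covectors *)

Section charts.
Context {R : realType} {n : nat} {M : topologicalType} {A : charted R n M}.
Hypothesis hA : smooth_manifold A.
Implicit Types (phi psi chi : chart R n M) (p q : M).

Lemma atlas_chart phi : atlas A phi -> is_chart phi.
Proof. by case: hA => _ _ + _ _; exact. Qed.

Lemma chart_at_atlas p : atlas A (chart_at A p).
Proof. by case: hA => _ _ _ /(_ p)[]. Qed.

Lemma chart_at_dom p : cdom (chart_at A p) p.
Proof. by case: hA => _ _ _ /(_ p)[]. Qed.

Lemma cmapK phi q : atlas A phi -> cdom phi q -> cinv phi (cmap phi q) = q.
Proof. by move=> /atlas_chart[_ _ + _ _]; exact. Qed.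

Lemma open_cimg phi : atlas A phi -> open (cimg phi).
Proof. by case/atlas_chart. Qed.

Definition overlap phi psi := cmap phi @` (cdom phi `&` cdom psi).

(** [cinv phi] is continuous only within the open set [cimg phi], hence the intersection. *)
Lemma open_cinv_preimage phi (X : set M) : atlas A phi -> open X ->
  open (cimg phi `&` cinv phi @^-1` X).
Proof.
move=> /atlas_chart[_ oI _ _ cI] oX.
by apply: (continuous_inP _ oI).1 => //; rewrite -continuous_open_subspace.
Qed.

Lemma open_overlap phi psi : atlas A phi -> atlas A psi ->
  open (overlap phi psi).
Proof.
move=> Aphi Apsi; have [oD _ _ _ _] := atlas_chart Apsi.
rewrite [X in open X](_ : _ = cimg phi `&` cinv phi @^-1` cdom psi).
  exact: open_cinv_preimage.
apply/seteqP; split => [_ [q [qphi qpsi] <-]|_ [[q qphi <-]]] /=.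
  by split; [exists q|rewrite cmapK].
by rewrite cmapK// => qpsi; exists q.
Qed.

Lemma overlap_nbhs phi psi q : atlas A phi -> atlas A psi ->
  cdom phi q -> cdom psi q -> nbhs (cmap phi q) (overlap phi psi).
Proof.
move=> Aphi Apsi qphi qpsi; apply: open_nbhs_nbhs; split.
  exact: open_overlap.
by exists q.
Qed.

Lemma smooth_transition phi psi : atlas A phi -> atlas A psi ->
  smooth_on (overlap phi psi) (cmap psi \o cinv phi).
Proof. by case: hA => _ _ _ _; exact. Qed.

Lemma differentiable_transition phi psi q : atlas A phi -> atlas A psi ->
  cdom phi q -> cdom psi q ->
  differentiable (cmap psi \o cinv phi) (cmap phi q).
Proof.
move=> Aphi Apsi qphi qpsi.
by apply: smooth_differentiable (smooth_transition Aphi Apsi) _; exists q.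
Qed.

(** Both [to_chart] and [from_chart] are instances, one of the two charts being the preferred chart
    at [q]. *)
Definition transition_mx phi psi q : 'M[R]_n :=
  'J (cmap psi \o cinv phi) (cmap phi q).

(** The chain rule: near the image of [q], passing through [psi] is the direct transition, because
    [cinv psi] undoes [cmap psi] on its domain. *)
Lemma transition_mx_cocycle phi psi chi q :
  atlas A phi -> atlas A psi -> atlas A chi ->
  cdom phi q -> cdom psi q -> cdom chi q ->
  transition_mx phi psi q *m transition_mx psi chi q = transition_mx phi chi q.
Proof.
move=> Aphi Apsi Achi qphi qpsi qchi; rewrite /transition_mx.
have dpp := differentiable_transition Aphi Apsi qphi qpsi.
have dpc := differentiable_transition Apsi Achi qpsi qchi.
have E : (cmap psi \o cinv phi) (cmap phi q) = cmap psi q by rewrite /= cmapK.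
move: dpc; rewrite -E => dpc; apply: etrans (esym (jacobian_comp dpp dpc)) _.
apply: near_eq_jacobian; first exact: differentiable_comp.
have := overlap_nbhs Aphi Apsi qphi qpsi; apply: filterS => _ [q' [q'phi q'psi] <-].
by rewrite /= cmapK//= cmapK.
Qed.

Lemma transition_mx_id phi q : atlas A phi -> cdom phi q ->
  transition_mx phi phi q = 1%:M.
Proof.
move=> Aphi qphi; apply: jacobian_id.
have := overlap_nbhs Aphi Aphi qphi qphi; apply: filterS => _ [q' [q'phi _] <-].
by rewrite /= cmapK.
Qed.

Section at_point.
Variables (phi : chart R n M) (q : M).
Hypotheses (Aphi : atlas A phi) (qphi : cdom phi q).

Lemma to_from_chart : to_chart A phi q *m from_chart A phi q = 1%:M.
Proof.
have Ac := chart_at_atlas q; have qc := chart_at_dom q.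
apply: etrans (transition_mx_cocycle Ac Aphi Ac qc qphi qc) _.
exact: transition_mx_id.
Qed.

Lemma from_to_chart : from_chart A phi q *m to_chart A phi q = 1%:M.
Proof. by apply: mulmx1C; exact: to_from_chart. Qed.

(** The chain rule again. The preferred chart varies with the point, so smoothness of df can be read
    only after this passage to a fixed chart. *)
Lemma from_chart_dfun f : smooth_fun A f ->
  from_chart A phi q *m dfun A f q = partials (f \o cinv phi) (cmap phi q).
Proof.
move=> fs; have Ac := chart_at_atlas q; have qc := chart_at_dom q.
have E : (cmap (chart_at A q) \o cinv phi) (cmap phi q) = coord_at A q.
  by rewrite /= (cmapK Aphi).
have df : differentiable (f \o cinv (chart_at A q)) (coord_at A q).
  by apply: smooth_differentiable (fs _ Ac) _; exists q.
have dF := differentiable_transition Aphi Ac qphi qc.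
rewrite -[dfun A f q]/(partials (f \o cinv (chart_at A q)) (coord_at A q)).
move: df; rewrite -E => df; apply: etrans (esym (partials_comp dF df)) _.
apply: near_eq_partials; have := overlap_nbhs Aphi Ac qphi qc.
by apply: filterS => _ [q' [q'phi q'c] <-]; rewrite /= (cmapK Aphi)// (cmapK Ac).
Qed.

End at_point.

Lemma smooth_dfun f : smooth_fun A f -> smooth_form1 A (dfun A f).
Proof.
move=> fs phi Aphi; have oI := open_cimg Aphi.
apply: eq_smooth_on (smooth_partials oI (fs _ Aphi)) => // _ [q qphi <-] /=.
by rewrite (cmapK Aphi)// from_chart_dfun.
Qed.

Lemma smooth_cometric (g : @tensor02 R n M) :
  nondegenerate02 g -> smooth02 A g -> smooth20 A (cometric g).
Proof.
move=> gU gs phi Aphi; have oI := open_cimg Aphi.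
have gE q (qphi : cdom phi q) :=
  invmx_congruence (from_to_chart Aphi qphi) (gU q).
apply: eq_smooth_on (smooth_invmx oI _ (gs _ Aphi)) => // _ [q qphi <-] /=;
  rewrite (cmapK Aphi)//; by have [] := gE q qphi.
Qed.

(** The components of the gradient in the fixed chart [phi], instead of the preferred chart that
    varies with [q]. *)
Definition grad_in (g : @tensor02 R n M) f phi q : 'rV[R]_n :=
  grad A g f q *m to_chart A phi q.

Lemma smooth_grad (g : @tensor02 R n M) f phi :
  nondegenerate02 g -> smooth02 A g -> smooth_fun A f -> atlas A phi ->
  smooth_on (cimg phi) (grad_in g f phi \o cinv phi).
Proof.
move=> gU gs fs Aphi; have oI := open_cimg Aphi.
have := smooth_mulmx oI (smooth_trmx oI (smooth_dfun fs Aphi))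
  (smooth_cometric gU gs Aphi).
apply: eq_smooth_on => // _ [q qphi <-] /=; rewrite (cmapK Aphi)//.
(* Between the components of df and those of the cometric, the two chart matrices are mutually
   inverse and cancel. *)
rewrite /grad_in /grad trmx_mul !mulmxA -[X in X *m _ *m _]mulmxA -trmx_mul.
by rewrite to_from_chart// trmx1 mulmx1.
Qed.

Lemma smooth_grad_sqnorm (g : @tensor02 R n M) f :
  nondegenerate02 g -> smooth02 A g -> smooth_fun A f ->
  smooth_fun A (grad_sqnorm A g f).
Proof.
move=> gU gs fs phi Aphi; have oI := open_cimg Aphi.
have := smooth_mulmx oI (smooth_grad gU gs fs Aphi) (smooth_dfun fs Aphi).
move/(smooth_mxP _ oI)/(_ 0 0).
apply: eq_smooth_on => // _ [q qphi <-] /=; rewrite (cmapK Aphi)//.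
rewrite /grad_sqnorm grad_spec// /grad_in !mulmxA -[X in X *m _]mulmxA.
by rewrite to_from_chart// mulmx1.
Qed.

(** The ball is closed and bounded in a finite-dimensional space, so its continuous image is
    compact, and compact sets are closed in a Hausdorff space. *)
Lemma cinv_closed_ball_closed phi (x : 'rV[R]_n) (r : R) : atlas A phi ->
  closed_ball_ Num.norm x r `<=` cimg phi ->
  closed (cinv phi @` closed_ball_ Num.norm x r).
Proof.
move=> Aphi xr; have [_ _ _ _ cI] := atlas_chart Aphi.
apply: compact_closed; first by case: hA.
apply: continuous_compact; first exact: continuous_subspaceW cI.
apply: bounded_closed_compact; last exact: closed_closed_ball_.
exists (`|x| + r); split; first exact: num_real.
move=> N /ltW xrN y /= xy; apply: le_trans xrN.
by rewrite -[y](subKr x) (le_trans (ler_normB _ _))// lerD2l.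
Qed.

(* Cut off, by a bump supported in the chart at p, the form that is constant in
   that chart. *)
Lemma form1_extension p (a : 'cV[R]_n) :
  exists2 w : @form1 R n M, smooth_form1 A w & w p = a.
Proof.
pose phi := chart_at A p.
have Aphi : atlas A phi by exact: chart_at_atlas.
have pphi : cdom phi p by exact: chart_at_dom.
pose x0 := cmap phi p.
have /nbhs_closedballP[r] : nbhs x0 (cimg phi).
  by apply: open_nbhs_nbhs; split; [exact: open_cimg|exists p].
rewrite closed_ballE// => xr.
have r0 : 0 < r%:num by [].
have b0 : cutoff x0 r%:num x0 != 0 by rewrite gt_eqF// cutoff_center.
(* Dividing by the value at the centre gives [s p = 1]. *)
pose s q := cutoff x0 r%:num (cmap phi q) / cutoff x0 r%:num x0.
(* The covector [to_chart A phi q *m a] has the constant components [a] in [phi]; the value is 0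
   outside the chart. *)
pose w q := if `[< cdom phi q >] then s q *: (to_chart A phi q *m a) else 0.
have win q : cdom phi q -> w q = s q *: (to_chart A phi q *m a).
  by move=> qphi; rewrite /w asboolT.
exists w; last first.
  rewrite win// /s divff// scale1r.
  have -> : to_chart A phi p = 1%:M by exact: (transition_mx_id Aphi pphi).
  by rewrite mul1mx.
move=> psi Apsi; apply: smooth_on_local; first exact: open_cimg.
(* Inside the domain of [phi] the form is explicit through the transition map; at a point outside
   it, the complement of the closed set [K] is a neighbourhood on which the form vanishes. *)
move=> _ [q qpsi <-]; have [qphi|qphi] := pselect (cdom phi q).
  have oV := open_overlap Apsi Aphi; have Fs := smooth_transition Apsi Aphi.
  exists (overlap psi phi); split=> //; first by exists q.
  have Js := smooth_mulmx oV (smooth_jacobian oV Fs) (smooth_cst _ a).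
  have Bs := smoothM oV (smooth_cutoff x0 r%:num oV Fs)
    (smooth_cst _ (cutoff x0 r%:num x0)^-1).
  apply: eq_smooth_on (smooth_scalemx oV Bs Js) => // _ [q' [q'psi q'phi] <-] /=.
  rewrite (cmapK Apsi q'psi) (win _ q'phi).
  have <- : from_chart A psi q' *m to_chart A phi q' =
      'J (cmap phi \o cinv psi) (cmap psi q').
    exact: (transition_mx_cocycle Apsi (chart_at_atlas q') Aphi q'psi
             (chart_at_dom q') q'phi).
  by rewrite -scalemxAr mulmxA.
pose K := cinv phi @` closed_ball_ Num.norm x0 r%:num.
have oK : open (~` K) by apply/closed_openC/cinv_closed_ball_closed.
exists (cimg psi `&` cinv psi @^-1` ~` K); split.
- exact: open_cinv_preimage.
- split; first by exists q.
  rewrite /= (cmapK Apsi)// => -[_ /xr[q' q'phi <-]].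
  by rewrite (cmapK Aphi)// => q'q; apply: qphi; rewrite -q'q.
- have oV := open_cinv_preimage Apsi oK.
  apply: eq_smooth_on (smooth_cst _ 0) => // _ [[q' q'psi <-]] /=.
  (* Off [K] the form vanishes: by default outside the chart, and inside it because the point lies
     beyond the radius of the cutoff. *)
  rewrite (cmapK Apsi)// => q'K; rewrite /w; case: asboolP => [q'phi|_].
    rewrite /s cutoff_out ?mul0r ?scale0r ?mulmx0// leNgt; apply/negP => q'r.
    apply: q'K; exists (cmap phi q'); last by rewrite (cmapK Aphi).
    by rewrite /closed_ball_ /= distrC ltW.
  by rewrite mulmx0.
Qed.

End charts.

(** * The product manifold *)

Section block_inverse.
Context {F : fieldType} {n1 n2 : nat}.
Variables (g1 : 'M[F]_n1) (g2 : 'M[F]_n2) (d1 : 'cV[F]_n1) (d2 : 'cV[F]_n2).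
Variables (c f1 f2 : F).

Let v1 := d1^T *m invmx g1.
Let v2 := d2^T *m invmx g2.

(* The announced cometric in block form; b1 and b2 are specialised later to
   v1 *m d1 and v2 *m d2. *)
Definition twisted_mx (b1 b2 : F) : 'M[F]_(n1 + n2) :=
  let D := 1 - c ^+ 2 * b1 * b2 in
  block_mx
    (f2 ^- 2 *: invmx g1 + (c ^+ 2 * b2 / (f2 ^+ 2 * D)) *: (v1^T *m v1))
    ((- c / (f1 * f2 * D)) *: (v1^T *m v2))
    ((- c / (f1 * f2 * D)) *: (v2^T *m v1))
    (f1 ^- 2 *: invmx g2 + (c ^+ 2 * b1 / (f1 ^+ 2 * D)) *: (v2^T *m v2)).

Hypotheses (g1S : g1^T = g1) (g2S : g2^T = g2).
Hypotheses (g1U : g1 \in unitmx) (g2U : g2 \in unitmx).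
Hypotheses (f1N0 : f1 != 0) (f2N0 : f2 != 0).

Let b1 := (v1 *m d1) 0 0.
Let b2 := (v2 *m d2) 0 0.
Hypothesis DN0 : 1 - c ^+ 2 * b1 * b2 != 0.

Let gv1 : g1 *m v1^T = d1.
Proof. by rewrite /v1 trmx_mul trmxK trmx_inv g1S mulKVmx. Qed.

Let gv2 : g2 *m v2^T = d2.
Proof. by rewrite /v2 trmx_mul trmxK trmx_inv g2S mulKVmx. Qed.

Let dv1 : d1^T *m v1^T = b1%:M.
Proof. by rewrite -trmx_mul [v1 *m d1]mx11_scalar tr_scalar_mx. Qed.

Let dv2 : d2^T *m v2^T = b2%:M.
Proof. by rewrite -trmx_mul [v2 *m d2]mx11_scalar tr_scalar_mx. Qed.

Lemma twisted_mxP :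
  block_mx (f2 ^+ 2 *: g1) ((c * f1 * f2) *: (d1 *m d2^T))
           ((c * f1 * f2) *: (d2 *m d1^T)) (f1 ^+ 2 *: g2)
  *m twisted_mx b1 b2 = 1%:M.
Proof.
rewrite /twisted_mx mulmx_block scalar_mx_block.
move: DN0; set D := 1 - _ => D0.
(* The relations [g_i v_i^T = d_i] and [d_i^T v_i^T = b_i] reduce every block to multiples of a
   [d_i *m v_j], plus an identity block on the diagonal; only scalar identities remain. *)
rewrite !mulmxDr -!scalemxAl -!scalemxAr !scalerA !mulmxA !gv1 !gv2.
rewrite -[d1 *m d2^T *m v2^T]mulmxA -[d2 *m d1^T *m v1^T]mulmxA dv1 dv2.
rewrite !mul_mx_scalar -!scalemxAl !scalerA !mulmxV//.
rewrite -[d1 *m d2^T *m invmx g2]mulmxA -/v2 -[d2 *m d1^T *m invmx g1]mulmxA -/v1.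
congr block_mx; rewrite -?addrA -?scalerDl.
- rewrite divff ?expf_neq0// scale1r -[RHS]addr0; congr (_ + _).
  apply/eqP; rewrite scaler_eq0; apply/orP; left; apply/eqP.
  by rewrite /D; field; rewrite f1N0 f2N0 DN0.
- apply/eqP; rewrite scaler_eq0; apply/orP; left; apply/eqP.
  by rewrite /D; field; rewrite f1N0 f2N0 DN0.
- apply/eqP; rewrite scaler_eq0; apply/orP; left; apply/eqP.
  by rewrite /D; field; rewrite f1N0 f2N0 DN0.
- rewrite addrCA -scalerDl divff ?expf_neq0// scale1r -[RHS]addr0; congr (_ + _).
  apply/eqP; rewrite scaler_eq0; apply/orP; left; apply/eqP.
  by rewrite /D; field; rewrite f1N0 f2N0 DN0.
Qed.
End block_inverse.

(** * Jacobians of linear maps and of product maps *)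

Section linear_jacobian.
Context {R : realType}.

Lemma continuous_mulmxr (m n : nat) (P : 'M[R]_(m, n)) :
  continuous (mulmxr P : 'rV[R]_m -> 'rV[R]_n).
Proof.
move=> x; apply: differentiable_continuous.
have := smooth_mulmx openT (@smooth_id R m setT) (smooth_cst _ P).
by move/smooth_differentiable; exact.
Qed.

Lemma differentiable_mulmxr (m n : nat) (P : 'M[R]_(m, n)) x :
  differentiable (mulmxr P : 'rV[R]_m -> 'rV[R]_n) x.
Proof. exact/linear_differentiable/continuous_mulmxr. Qed.

Lemma jacobian_mulmxr (m n : nat) (P : 'M[R]_(m, n)) x :
  'J (mulmxr P) x = P.
Proof.
apply: etrans (near_linear_jacobian (@continuous_mulmxr _ _ P) _) _.
  by near=> y.
by apply/row_matrixP => i; rewrite rowE mul_rV_lin1 /= -rowE.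
Unshelve. all: by end_near. Qed.

Lemma jacobianD (m n : nat) (f g : 'rV[R]_m -> 'rV[R]_n) x :
  differentiable f x -> differentiable g x ->
  'J (f + g) x = 'J f x + 'J g x.
Proof.
move=> df dg; apply/row_matrixP => i.
have dfg : differentiable (f + g) x by exact: differentiableD.
have -> : row i ('J f x + 'J g x) = row i ('J f x) + row i ('J g x).
  exact: raddfD.
apply: etrans (row_jacobian i dfg) _.
rewrite deriveD; [|exact: diff_derivable..].
by congr (_ + _); apply/esym; exact: row_jacobian.
Qed.

(** As a matrix product, the projection has the Jacobian given by [jacobian_mulmxr]. *)
Lemma lsubmxE (n1 n2 : nat) :
  lsubmx = mulmxr (col_mx 1%:M 0) :> ('rV[R]_(n1 + n2) -> 'rV[R]_n1).
Proof.
apply/funext => x; rewrite -[x in RHS]hsubmxK /= mul_row_col.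
by rewrite mulmx1 mulmx0 addr0.
Qed.

Lemma rsubmxE (n1 n2 : nat) :
  rsubmx = mulmxr (col_mx 0 1%:M) :> ('rV[R]_(n1 + n2) -> 'rV[R]_n2).
Proof.
apply/funext => x; rewrite -[x in RHS]hsubmxK /= mul_row_col.
by rewrite mulmx1 mulmx0 add0r.
Qed.

(** The map is the sum of two terms, each a projection onto one factor, followed by [F1] or [F2],
    followed by the inclusion of that factor; the chain rule applies to each. *)
Lemma jacobian_prod (m1 m2 n1 n2 : nat) (F1 : 'rV[R]_m1 -> 'rV[R]_n1)
    (F2 : 'rV[R]_m2 -> 'rV[R]_n2) (x : 'rV[R]_(m1 + m2)) :
  differentiable F1 (lsubmx x) -> differentiable F2 (rsubmx x) ->
  'J (fun y => row_mx (F1 (lsubmx y)) (F2 (rsubmx y))) x =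
  block_mx ('J F1 (lsubmx x)) 0 0 ('J F2 (rsubmx x)).
Proof.
rewrite lsubmxE rsubmxE => d1 d2.
pose L1 : 'M[R]_(m1 + m2, m1) := col_mx 1%:M 0.
pose L2 : 'M[R]_(m1 + m2, m2) := col_mx 0 1%:M.
pose P1 : 'M[R]_(n1, n1 + n2) := row_mx 1%:M 0.
pose P2 : 'M[R]_(n2, n1 + n2) := row_mx 0 1%:M.
have -> : (fun y => row_mx (F1 (mulmxr L1 y)) (F2 (mulmxr L2 y))) =
    (mulmxr P1 \o (F1 \o mulmxr L1)) + (mulmxr P2 \o (F2 \o mulmxr L2)).
  apply/funext => y; rewrite -[RHS]/(_ *m P1 + _ *m P2) /= !mul_mx_row.
  by rewrite !mulmx1 !mulmx0 add_row_mx addr0 add0r.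
have dL1 := differentiable_mulmxr L1 x; have dL2 := differentiable_mulmxr L2 x.
have dF1 : differentiable (F1 \o mulmxr L1) x by exact: differentiable_comp.
have dF2 : differentiable (F2 \o mulmxr L2) x by exact: differentiable_comp.
have dP1 := differentiable_mulmxr P1 ((F1 \o mulmxr L1) x).
have dP2 := differentiable_mulmxr P2 ((F2 \o mulmxr L2) x).
apply: etrans (jacobianD (differentiable_comp dF1 dP1)
                         (differentiable_comp dF2 dP2)) _.
rewrite (jacobian_comp dF1 dP1) (jacobian_comp dF2 dP2).
rewrite (jacobian_comp dL1 d1) (jacobian_comp dL2 d2) !jacobian_mulmxr.
move: ('J F1 _) ('J F2 _) => J1 J2.
rewrite /L1 /L2 /P1 /P2 !mul_col_mx !(mul1mx, mul0mx) !mul_mx_row.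
by rewrite !(mulmx0, mulmx1) add_col_mx addr0 add0r -block_mxEv.
Qed.

End linear_jacobian.

(** * Lifts and product charts *)

Section product_manifold.
Context {R : realType} {n1 n2 : nat} {M1 M2 : topologicalType}.
Context {A1 : charted R n1 M1} {A2 : charted R n2 M2}.
Hypotheses (hA1 : smooth_manifold A1) (hA2 : smooth_manifold A2).
Let A := prod_charted A1 A2.

Lemma hlift_form1E (a : @form1 R n1 M1) p :
  hlift_form1 A1 A2 a p = col_mx (a p.1) 0.
Proof.
rewrite -[LHS]/(dpi1 A1 A2 p *m a p.1) (dpi1E _ hA1).
by rewrite mul_col_mx mul1mx mul0mx.
Qed.

Lemma vlift_form1E (a : @form1 R n2 M2) p :
  vlift_form1 A1 A2 a p = col_mx 0 (a p.2).
Proof.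
rewrite -[LHS]/(dpi2 A1 A2 p *m a p.2) (dpi2E _ hA2).
by rewrite mul_col_mx mul1mx mul0mx.
Qed.

Lemma product_metricE c (g1 : @tensor02 R n1 M1) (g2 : @tensor02 R n2 M2) f1 f2 p :
  let d1 := dfun A1 f1 p.1 in let d2 := dfun A2 f2 p.2 in
  product_metric A1 A2 c g1 g2 f1 f2 p =
  block_mx (f2 p.2 ^+ 2 *: g1 p.1) ((c * f1 p.1 * f2 p.2) *: (d1 *m d2^T))
           ((c * f1 p.1 * f2 p.2) *: (d2 *m d1^T)) (f1 p.1 ^+ 2 *: g2 p.2).
Proof.
move=> d1 d2; rewrite /product_metric /fodot /ftensor hlift_form1E vlift_form1E.
have -> : pullback02 A A1 fst g1 p = block_mx (g1 p.1) 0 0 0.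
  rewrite -[LHS]/(dpi1 A1 A2 p *m g1 p.1 *m (dpi1 A1 A2 p)^T) (dpi1E _ hA1).
  rewrite mul_col_mx tr_col_mx mul_col_row trmx1 trmx0.
  by rewrite !(mul1mx, mulmx1, mul0mx, mulmx0).
have -> : pullback02 A A2 snd g2 p = block_mx 0 0 0 (g2 p.2).
  rewrite -[LHS]/(dpi2 A1 A2 p *m g2 p.2 *m (dpi2 A1 A2 p)^T) (dpi2E _ hA2).
  rewrite mul_col_mx tr_col_mx mul_col_row trmx1 trmx0.
  by rewrite !(mul1mx, mulmx1, mul0mx, mulmx0).
rewrite !tr_col_mx !mul_col_row !trmx0 !(mul0mx, mulmx0).
rewrite !(add_block_mx, scale_block_mx) !(scaler0, addr0, add0r).
by [].
Qed.


Lemma open_cimg_prod phi1 phi2 : atlas A1 phi1 -> atlas A2 phi2 ->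
  open (cimg (prod_chart phi1 phi2)) /\
  cimg (prod_chart phi1 phi2) =
    (lsubmx @^-1` cimg phi1) `&` (rsubmx @^-1` cimg phi2).
Proof.
move=> Aphi1 Aphi2.
have -> : cimg (prod_chart phi1 phi2) =
    (lsubmx @^-1` cimg phi1) `&` (rsubmx @^-1` cimg phi2).
  apply/seteqP; split=> [_ [[q1 q2] [/= q1d q2d] <-]|x [[q1 q1d q1x] [q2 q2d q2x]]].
    by split; rewrite /= ?row_mxKl ?row_mxKr; [exists q1|exists q2].
  by exists (q1, q2) => //=; rewrite q1x q2x hsubmxK.
split=> //; apply: openI; apply: open_comp.
- by move=> x _; exact: continuous_lsubmx.
- exact: open_cimg Aphi1.
- by move=> x _; exact: continuous_rsubmx.
- exact: open_cimg Aphi2.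
Qed.

Lemma smooth_lsubmx (W : normedModType R) phi1 phi2 (f : 'rV[R]_n1 -> W) :
  atlas A1 phi1 -> atlas A2 phi2 -> smooth_on (cimg phi1) f ->
  smooth_on (cimg (prod_chart phi1 phi2)) (f \o lsubmx).
Proof.
move=> Aphi1 Aphi2 fs; have [_ ->] := open_cimg_prod Aphi1 Aphi2.
apply: smooth_on_subset (smooth_comp_linear _ (open_cimg hA1 Aphi1) fs).
  by move=> x [].
exact: continuous_lsubmx.
Qed.

Lemma smooth_rsubmx (W : normedModType R) phi1 phi2 (f : 'rV[R]_n2 -> W) :
  atlas A1 phi1 -> atlas A2 phi2 -> smooth_on (cimg phi2) f ->
  smooth_on (cimg (prod_chart phi1 phi2)) (f \o rsubmx).
Proof.
move=> Aphi1 Aphi2 fs; have [_ ->] := open_cimg_prod Aphi1 Aphi2.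
apply: smooth_on_subset (smooth_comp_linear _ (open_cimg hA2 Aphi2) fs).
  by move=> x [].
exact: continuous_rsubmx.
Qed.

(** The preferred chart of the product is the product of the preferred charts, so the transition is
    a product map. *)
Lemma to_chart_prod phi1 phi2 p : atlas A1 phi1 -> atlas A2 phi2 ->
  cdom phi1 p.1 -> cdom phi2 p.2 ->
  to_chart A (prod_chart phi1 phi2) p =
  block_mx (to_chart A1 phi1 p.1) 0 0 (to_chart A2 phi2 p.2).
Proof.
move=> Aphi1 Aphi2 p1d p2d.
have d1 := differentiable_transition hA1 (chart_at_atlas hA1 p.1) Aphi1
  (chart_at_dom hA1 p.1) p1d.
have d2 := differentiable_transition hA2 (chart_at_atlas hA2 p.2) Aphi2
  (chart_at_dom hA2 p.2) p2d.
have := @jacobian_prod _ _ _ _ _ _ _ (coord_at A p).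
rewrite /coord_at /= row_mxKl row_mxKr => /(_ _ _ _ _ d1 d2).
exact.
Qed.

End product_manifold.

(** A block diagonal change of frame keeps the shape of the twisted matrix and only replaces the
    inverse metrics and gradients of the factors by their components in the new frame. *)
Lemma twisted_mx_congruence (F : fieldType) (n1 n2 : nat)
    (g1 : 'M[F]_n1) (g2 : 'M[F]_n2) (d1 : 'cV[F]_n1) (d2 : 'cV[F]_n2)
    (c f1 f2 b1 b2 : F) (t1 : 'M[F]_n1) (t2 : 'M[F]_n2) :
  let w1 := d1^T *m invmx g1 *m t1 in let w2 := d2^T *m invmx g2 *m t2 in
  let D := 1 - c ^+ 2 * b1 * b2 in
  (block_mx t1 0 0 t2)^T *m twisted_mx g1 g2 d1 d2 c f1 f2 b1 b2
    *m block_mx t1 0 0 t2 =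
  block_mx
    (f2 ^- 2 *: (t1^T *m invmx g1 *m t1) +
     (c ^+ 2 * b2 / (f2 ^+ 2 * D)) *: (w1^T *m w1))
    ((- c / (f1 * f2 * D)) *: (w1^T *m w2))
    ((- c / (f1 * f2 * D)) *: (w2^T *m w1))
    (f1 ^- 2 *: (t2^T *m invmx g2 *m t2) +
     (c ^+ 2 * b1 / (f1 ^+ 2 * D)) *: (w2^T *m w2)).
Proof.
move=> w1 w2 D; rewrite /twisted_mx -/D tr_block_mx !trmx0 !mulmx_block.
rewrite !(mul0mx, mulmx0, addr0, add0r) !(mulmxDr, mulmxDl).
rewrite /w1 /w2 !(trmx_mul _ t1) !(trmx_mul _ t2).
by rewrite -!scalemxAr -!scalemxAl !mulmxA.
Qed.

(** * The cometric of the product metric and its smoothness *)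

Section product_cometric.
Context {R : realType} {n1 n2 : nat} {M1 M2 : topologicalType}.
Context {A1 : charted R n1 M1} {A2 : charted R n2 M2}.
Hypotheses (hA1 : smooth_manifold A1) (hA2 : smooth_manifold A2).
Let A := prod_charted A1 A2.
Variables (g1 : @tensor02 R n1 M1) (g2 : @tensor02 R n2 M2).
Hypotheses (g1U : nondegenerate02 g1) (g2U : nondegenerate02 g2).
Variables (f1 : M1 -> R) (f2 : M2 -> R) (c : R).
Hypotheses (f1N0 : forall p, f1 p != 0) (f2N0 : forall p, f2 p != 0).

Let b1 := grad_sqnorm A1 g1 f1.
Let b2 := grad_sqnorm A2 g2 f2.
Hypothesis DN0 : forall p1 p2, 1 - c ^+ 2 * b1 p1 * b2 p2 != 0.

Definition twisted_tensor : @tensor20 R (n1 + n2) (M1 * M2)%type := fun p =>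
  twisted_mx (g1 p.1) (g2 p.2) (dfun A1 f1 p.1) (dfun A2 f2 p.2)
    c (f1 p.1) (f2 p.2) (b1 p.1) (b2 p.2).

(** A one-sided inverse of a square matrix is two-sided, so [twisted_mxP] gives nondegeneracy and
    the cometric at once. Its scalars are identified by [grad_spec]: the squared norm of grad f is
    df(grad f). *)
Lemma cometric_product_metric : symmetric02 g1 -> symmetric02 g2 -> forall p,
  product_metric A1 A2 c g1 g2 f1 f2 p \in unitmx /\
  cometric (product_metric A1 A2 c g1 g2 f1 f2) p = twisted_tensor p.
Proof.
move=> g1S g2S p.
have b1E : b1 p.1 = ((dfun A1 f1 p.1)^T *m invmx (g1 p.1) *m dfun A1 f1 p.1) 0 0.
  by rewrite /b1 /grad_sqnorm grad_spec.
have b2E : b2 p.2 = ((dfun A2 f2 p.2)^T *m invmx (g2 p.2) *m dfun A2 f2 p.2) 0 0.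
  by rewrite /b2 /grad_sqnorm grad_spec.
have := twisted_mxP (c := c) (g1S p.1) (g2S p.2) (g1U p.1) (g2U p.2)
  (f1N0 p.1) (f2N0 p.2) (d1 := dfun A1 f1 p.1) (d2 := dfun A2 f2 p.2).
rewrite -b1E -b2E => /(_ (DN0 _ _)); rewrite -product_metricE// => GT.
have [GU _] := mulmx1_unit GT; split=> //.
by rewrite /cometric; apply: (can_inj (mulKmx GU)); rewrite mulmxV.
Qed.

Hypotheses (g1s : smooth02 A1 g1) (g2s : smooth02 A2 g2).
Hypotheses (f1s : smooth_fun A1 f1) (f2s : smooth_fun A2 f2).

Lemma smooth_twisted_tensor : smooth20 A twisted_tensor.
Proof.
move=> _ [phi1 Aphi1 [phi2 Aphi2 <-]].
have [oW _] := open_cimg_prod hA1 hA2 Aphi1 Aphi2.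
have H1 := smooth_lsubmx hA1 hA2 Aphi1 Aphi2 (smooth_cometric hA1 g1U g1s Aphi1).
have H2 := smooth_rsubmx hA1 hA2 Aphi1 Aphi2 (smooth_cometric hA2 g2U g2s Aphi2).
have W1 := smooth_lsubmx hA1 hA2 Aphi1 Aphi2 (smooth_grad hA1 g1U g1s f1s Aphi1).
have W2 := smooth_rsubmx hA1 hA2 Aphi1 Aphi2 (smooth_grad hA2 g2U g2s f2s Aphi2).
have B1 := smooth_lsubmx hA1 hA2 Aphi1 Aphi2
  (smooth_grad_sqnorm hA1 g1U g1s f1s Aphi1).
have B2 := smooth_rsubmx hA1 hA2 Aphi1 Aphi2
  (smooth_grad_sqnorm hA2 g2U g2s f2s Aphi2).
have F1 := smooth_lsubmx hA1 hA2 Aphi1 Aphi2 (f1s Aphi1).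
have F2 := smooth_rsubmx hA1 hA2 Aphi1 Aphi2 (f2s Aphi2).
set W := cimg _ in oW H1 H2 W1 W2 B1 B2 F1 F2 *.
pose C (a : R) := @smooth_cst R (n1 + n2) R W a.
have Ds := smoothD oW (C 1) (smoothM oW (C (-1))
  (smoothM oW (smoothM oW (C (c ^+ 2)) B1) B2)).
have F1i := smoothV oW (fun x _ => f1N0 _) F1.
have F2i := smoothV oW (fun x _ => f2N0 _) F2.
have Di : smooth_on W (fun x => (1 - c ^+ 2 * b1 (cinv phi1 (lsubmx x)) *
                             b2 (cinv phi2 (rsubmx x)))^-1).
  apply: (smoothV oW); first by move=> x _; exact: DN0.
  by apply: eq_fun_smooth Ds => x; rewrite mulN1r.
have K1 := smoothM oW (smoothM oW (C (c ^+ 2)) B2)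
  (smoothM oW (smoothX 2 oW F2i) Di).
have K2 := smoothM oW (smoothM oW (C (c ^+ 2)) B1)
  (smoothM oW (smoothX 2 oW F1i) Di).
have K := smoothM oW (C (- c)) (smoothM oW (smoothM oW F1i F2i) Di).
(* The blocks are assembled in the shape produced by [twisted_mx_congruence], from factor components
   composed with the projections. *)
have := smooth_block_mx oW
  (smoothD oW (smooth_scalemx oW (smoothX 2 oW F2i) H1)
     (smooth_scalemx oW K1 (smooth_mulmx oW (smooth_trmx oW W1) W1)))
  (smooth_scalemx oW K (smooth_mulmx oW (smooth_trmx oW W1) W2))
  (smooth_scalemx oW K (smooth_mulmx oW (smooth_trmx oW W2) W1))
  (smoothD oW (smooth_scalemx oW (smoothX 2 oW F1i) H2)
     (smooth_scalemx oW K2 (smooth_mulmx oW (smooth_trmx oW W2) W2))).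
apply: eq_smooth_on => // _ [[q1 q2] [/= q1d q2d] <-].
rewrite /= row_mxKl row_mxKr (cmapK hA1 Aphi1 q1d) (cmapK hA2 Aphi2 q2d).
rewrite (to_chart_prod hA1 hA2 (p := (q1, q2)) Aphi1 Aphi2 q1d q2d).
rewrite /twisted_tensor twisted_mx_congruence /= /grad_in /grad /cometric.
by rewrite -/b1 -/b2 !expr2 !invfM.
Qed.

End product_cometric.

(** Passage from blocks to tensors: [i1] and [i2] are the matrices of the horizontal and vertical
    lifts, so [v1] and [v2] are the lifted gradients. *)
Lemma twisted_mxE (F : fieldType) (n1 n2 : nat)
    (g1 : 'M[F]_n1) (g2 : 'M[F]_n2) (d1 : 'cV[F]_n1) (d2 : 'cV[F]_n2)
    (c f1 f2 b1 b2 : F) :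
  let D := 1 - c ^+ 2 * b1 * b2 in
  let i1 : 'M[F]_(n1, n1 + n2) := row_mx 1%:M 0 in
  let i2 : 'M[F]_(n2, n1 + n2) := row_mx 0 1%:M in
  let v1 := d1^T *m invmx g1 *m i1 in let v2 := d2^T *m invmx g2 *m i2 in
  twisted_mx g1 g2 d1 d2 c f1 f2 b1 b2 =
  (1 / f2) ^+ 2 *: (i1^T *m invmx g1 *m i1)
  + (1 / f1) ^+ 2 *: (i2^T *m invmx g2 *m i2)
  + (1 / D) *: ((c ^+ 2 * b2 / f2 ^+ 2) *: (v1^T *m v1)
                + (c ^+ 2 * b1 / f1 ^+ 2) *: (v2^T *m v2)
                - (c / (f1 * f2)) *: (v1^T *m v2 + v2^T *m v1)).
Proof.
move=> D i1 i2 v1 v2.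
have -> : v1 = row_mx (d1^T *m invmx g1) 0.
  by rewrite /v1 mul_mx_row mulmx1 mulmx0.
have -> : v2 = row_mx 0 (d2^T *m invmx g2).
  by rewrite /v2 mul_mx_row mulmx1 mulmx0.
rewrite /twisted_mx -/D /i1 /i2 !tr_row_mx ![col_mx _ _ *m invmx _]mul_col_mx !mul_col_row.
rewrite !trmx0 !trmx1 !(mul1mx, mulmx1, mul0mx, mulmx0) -[- (_ *: _)]scaleNr.
rewrite !(add_block_mx, scale_block_mx, addr0, add0r, scaler0) !scalerA !div1r.
rewrite !exprVn !invfM.
congr block_mx.
- by congr (_ + _ *: _); ring.
- by congr (_ *: _); ring.
- by congr (_ *: _); ring.
- by congr (_ + _ *: _); ring.
Qed.

(** A lifted form has one nonzero block, so each evaluation sees a single block of the matrix. *)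
Lemma twisted_mx_eval (F : fieldType) (n1 n2 : nat)
    (g1 : 'M[F]_n1) (g2 : 'M[F]_n2) (d1 : 'cV[F]_n1) (d2 : 'cV[F]_n2)
    (c f1 f2 b1 b2 : F) (a1 e1 : 'cV[F]_n1) (a2 e2 : 'cV[F]_n2) :
  g1^T = g1 -> g2^T = g2 ->
  let T := twisted_mx g1 g2 d1 d2 c f1 f2 b1 b2 in
  let D := 1 - c ^+ 2 * b1 * b2 in
  let ip1 (u v : 'cV_n1) := (u^T *m invmx g1 *m v) 0 0 in
  let ip2 (u v : 'cV_n2) := (u^T *m invmx g2 *m v) 0 0 in
  [/\ ((col_mx a1 0)^T *m T *m col_mx e1 0) 0 0 =
        1 / f2 ^+ 2 * (ip1 a1 e1 + c ^+ 2 * b2 / D * ip1 a1 d1 * ip1 e1 d1),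
      ((col_mx 0 a2)^T *m T *m col_mx 0 e2) 0 0 =
        1 / f1 ^+ 2 * (ip2 a2 e2 + c ^+ 2 * b1 / D * ip2 a2 d2 * ip2 e2 d2),
      ((col_mx a1 0)^T *m T *m col_mx 0 e2) 0 0 =
        - c / (f1 * f2 * D) * ip1 a1 d1 * ip2 e2 d2
    & ((col_mx 0 a2)^T *m T *m col_mx e1 0) 0 0 =
        - c / (f1 * f2 * D) * ip2 a2 d2 * ip1 e1 d1].
Proof.
move=> g1S g2S T D ip1 ip2.
have tr1 u : u^T *m (d1^T *m invmx g1)^T = (ip1 u d1)%:M.
  by rewrite trmx_mul trmxK trmx_inv g1S mulmxA -mx11_scalar.
have tr2 u : u^T *m (d2^T *m invmx g2)^T = (ip2 u d2)%:M.
  by rewrite trmx_mul trmxK trmx_inv g2S mulmxA -mx11_scalar.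
have tl1 u : d1^T *m invmx g1 *m u = (ip1 u d1)%:M.
  by apply: trmx_inj; rewrite trmx_mul tr1 tr_scalar_mx.
have tl2 u : d2^T *m invmx g2 *m u = (ip2 u d2)%:M.
  by apply: trmx_inj; rewrite trmx_mul tr2 tr_scalar_mx.
(* A rank-one term evaluates to the product of its two contractions, here the pairings with [d1] and
   [d2]. *)
have outer k l (a : 'rV[F]_k) v w (b : 'cV[F]_l) (s t : 'M[F]_1) :
    a *m v = s -> w *m b = t -> a *m (v *m w) *m b = s *m t.
  by move=> <- <-; rewrite !mulmxA.
have dot (x y : F) : (x%:M *m y%:M : 'M[F]_1) 0 0 = x * y.
  by rewrite -scalar_mxM mxE eqxx mulr1n.
rewrite /T /twisted_mx -/D.
split; rewrite tr_col_mx trmx0 mul_row_block mul_row_col;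
  rewrite !(mul0mx, mulmx0, addr0, add0r) ?mulmxDr ?mulmxDl -!scalemxAr -!scalemxAl.
- rewrite (outer _ _ _ _ _ _ _ _ (tr1 _) (tl1 _)).
  rewrite mxE [in X in X + _]mxE [in X in _ + X]mxE dot.
  by rewrite mul1r !invfM -/(ip1 _ _); ring.
- rewrite (outer _ _ _ _ _ _ _ _ (tr2 _) (tl2 _)).
  rewrite mxE [in X in X + _]mxE [in X in _ + X]mxE dot.
  by rewrite mul1r !invfM -/(ip2 _ _); ring.
- rewrite (outer _ _ _ _ _ _ _ _ (tr1 _) (tl2 _)).
  by rewrite mxE dot mulrA.
- rewrite (outer _ _ _ _ _ _ _ _ (tr2 _) (tl1 _)).
  by rewrite mxE dot mulrA.
Qed.

(** * Separation of tensors by lifted forms *)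

Section uniqueness.
Context {R : realType} {n1 n2 : nat} {M1 M2 : topologicalType}.
Context {A1 : charted R n1 M1} {A2 : charted R n2 M2}.
Hypotheses (hA1 : smooth_manifold A1) (hA2 : smooth_manifold A2).

(** Every covector at [p] is the sum of a horizontal and a vertical one, each the value at [p] of a
    lifted global smooth form; bilinearity and the four mixed cases then determine the tensor at
    [p]. *)
Lemma tensor20_eq_on_lifts (T S : @tensor20 R (n1 + n2) (M1 * M2)%type) :
  (forall (al1 be1 : @form1 R n1 M1) (al2 be2 : @form1 R n2 M2),
     smooth_form1 A1 al1 -> smooth_form1 A1 be1 ->
     smooth_form1 A2 al2 -> smooth_form1 A2 be2 ->
     let al1h := hlift_form1 A1 A2 al1 in
     let be1h := hlift_form1 A1 A2 be1 in
     let al2v := vlift_form1 A1 A2 al2 in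
     let be2v := vlift_form1 A1 A2 be2 in
     forall p,
     [/\ eval20 T al1h be1h p = eval20 S al1h be1h p,
         eval20 T al2v be2v p = eval20 S al2v be2v p,
         eval20 T al1h be2v p = eval20 S al1h be2v p
       & eval20 T al2v be1h p = eval20 S al2v be1h p]) ->
  T = S.
Proof.
move=> TS; apply/funext => p; apply: bilinear_mx_inj => a b.
have [al1 al1s al1p] := form1_extension hA1 p.1 (usubmx a).
have [be1 be1s be1p] := form1_extension hA1 p.1 (usubmx b).
have [al2 al2s al2p] := form1_extension hA2 p.2 (dsubmx a).
have [be2 be2s be2p] := form1_extension hA2 p.2 (dsubmx b).
have [] := TS _ _ _ _ al1s be1s al2s be2s p.
rewrite /eval20 !hlift_form1E// !vlift_form1E// al1p al2p be1p be2p.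
move=> E11 E22 E12 E21.
have entryD (X Y : 'M[R]_1) : (X + Y) 0 0 = X 0 0 + Y 0 0 by rewrite mxE.
have split_col (x : 'cV[R]_(n1 + n2)) :
    x = col_mx (usubmx x) 0 + col_mx 0 (dsubmx x).
  by rewrite add_col_mx addr0 add0r vsubmxK.
rewrite (split_col a) (split_col b) [(_ + _)^T]linearD /= !mulmxDl !mulmxDr.
by rewrite !entryD E11 E22 E12 E21.
Qed.

End uniqueness.

Theorem proposition2 (R : realType) (n1 n2 : nat) (M1 M2 : topologicalType)
  (A1 : charted R n1 M1) (A2 : charted R n2 M2)
  (hM1 : smooth_manifold A1) (hM2 : smooth_manifold A2)
  (g1 : @tensor02 R n1 M1) (g2 : @tensor02 R n2 M2)
  (hg1 : pseudo_riemannian A1 g1) (hg2 : pseudo_riemannian A2 g2)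
  (f1 : M1 -> R) (f2 : M2 -> R)
  (hf1 : smooth_fun A1 f1) (hf2 : smooth_fun A2 f2)
  (f1_gt0 : forall p, 0 < f1 p) (f2_gt0 : forall p, 0 < f2 p)
  (c : R)
  (hb : forall p : M1 * M2,
     0 <= c ^+ 2 * hlift_fun (grad_sqnorm A1 g1 f1) p
               * vlift_fun (grad_sqnorm A2 g2 f2) p < 1) :
  let A := prod_charted A1 A2 in
  let G := product_metric A1 A2 c g1 g2 f1 f2 in
  let f1h : M1 * M2 -> R := hlift_fun f1 in
  let f2v : M1 * M2 -> R := vlift_fun f2 in
  let b1h : M1 * M2 -> R := hlift_fun (grad_sqnorm A1 g1 f1) in
  let b2v : M1 * M2 -> R := vlift_fun (grad_sqnorm A2 g2 f2) in
  let D := fun p : M1 * M2 => 1 - c ^+ 2 * b1h p * b2v p in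
  let grad1h := hlift_vf A1 A2 (grad A1 g1 f1) in
  let grad2v := vlift_vf A1 A2 (grad A2 g2 f2) in
  (* e1 a is the horizontal lift of the cometric of g1 at (a, df1), and e2 a
     the vertical lift of the cometric of g2 at (a, df2) *)
  let e1 := fun a : @form1 R n1 M1 =>
    hlift_fun (eval20 (cometric g1) a (dfun A1 f1)) : M1 * M2 -> R in
  let e2 := fun a : @form1 R n2 M2 =>
    vlift_fun (eval20 (cometric g2) a (dfun A2 f2)) : M1 * M2 -> R in
  [/\ nondegenerate02 G,
      forall p : M1 * M2,
        cometric G p =
          (1 / f2v p) ^+ 2 *: hlift20 A1 A2 (cometric g1) p
          + (1 / f1h p) ^+ 2 *: vlift20 A1 A2 (cometric g2) p
          + (1 / D p) *:
              ((c ^+ 2 * b2v p / f2v p ^+ 2) *: vtensor grad1h grad1h p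
               + (c ^+ 2 * b1h p / f1h p ^+ 2) *: vtensor grad2v grad2v p
               - (c / (f1h p * f2v p)) *: vodot grad1h grad2v p)
    & unique
        (fun T : @tensor20 R (n1 + n2) (M1 * M2)%type =>
           smooth20 A T /\
           forall (al1 be1 : @form1 R n1 M1) (al2 be2 : @form1 R n2 M2),
             smooth_form1 A1 al1 -> smooth_form1 A1 be1 ->
             smooth_form1 A2 al2 -> smooth_form1 A2 be2 ->
             let al1h := hlift_form1 A1 A2 al1 in
             let be1h := hlift_form1 A1 A2 be1 in
             let al2v := vlift_form1 A1 A2 al2 in
             let be2v := vlift_form1 A1 A2 be2 in
             forall p : M1 * M2,
             [/\ eval20 T al1h be1h p =
                   1 / f2v p ^+ 2 *
                   (hlift_fun (eval20 (cometric g1) al1 be1) p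
                    + c ^+ 2 * b2v p / D p * e1 al1 p * e1 be1 p),
                 eval20 T al2v be2v p =
                   1 / f1h p ^+ 2 *
                   (vlift_fun (eval20 (cometric g2) al2 be2) p
                    + c ^+ 2 * b1h p / D p * e2 al2 p * e2 be2 p),
                 eval20 T al1h be2v p =
                   - c / (f1h p * f2v p * D p) * e1 al1 p * e2 be2 p
               & eval20 T al2v be1h p =
                   - c / (f1h p * f2v p * D p) * e2 al2 p * e1 be1 p])
        (cometric G)].
Proof.

move=> A G f1h f2v b1h b2v D grad1h grad2v e1 e2.
have [g1s g1S g1U _] := hg1; have [g2s g2S g2U _] := hg2.
have f1N0 p : f1 p != 0 by rewrite gt_eqF.
have f2N0 p : f2 p != 0 by rewrite gt_eqF.
(* The strict upper bound on [c^2 b1 b2], taken at the point [(p1, p2)], makes the denominator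
   nonzero. *)
have DN0 p1 p2 :
    1 - c ^+ 2 * grad_sqnorm A1 g1 f1 p1 * grad_sqnorm A2 g2 f2 p2 != 0.
  by have /andP[_ lt1] := hb (p1, p2); rewrite subr_eq0 eq_sym lt_eqF.
have GE p := cometric_product_metric hM1 hM2 g1U g2U f1N0 f2N0 DN0 g1S g2S p.
have cGE : cometric G = twisted_tensor (A1 := A1) (A2 := A2) g1 g2 f1 f2 c.
  by apply/funext => p; have [] := GE p.
have sG : smooth20 A (cometric G).
  by rewrite cGE; exact: smooth_twisted_tensor.
have evG al1 be1 al2 be2 p := twisted_mx_eval (dfun A1 f1 p.1) (dfun A2 f2 p.2)
  c (f1 p.1) (f2 p.2) (grad_sqnorm A1 g1 f1 p.1) (grad_sqnorm A2 g2 f2 p.2)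
  (al1 p.1) (be1 p.1) (al2 p.2) (be2 p.2) (g1S p.1) (g2S p.2).
split.
- by move=> p; have [] := GE p.
- move=> p; rewrite cGE /twisted_tensor /twisted_mx.
  rewrite /hlift20 /vlift20 /vodot /vtensor /grad1h /grad2v /hlift_vf /vlift_vf.
  (* The lifts, chosen by [get], are the two block inclusions, and the formula becomes
     [twisted_mxE]. *)
  rewrite hlift_mxE// vlift_mxE//; exact: twisted_mxE.
- split.
  split=> [|al1 be1 al2 be2 _ _ _ _ al1h be1h al2v be2v p]; first exact: sG.
  rewrite cGE /eval20 /al1h /be1h /al2v /be2v.
  rewrite !(hlift_form1E hM1) !(vlift_form1E hM2); exact: evG.
(* A competitor [T] takes on lifted forms the values prescribed by the same formulas, hence agrees
   there with the cometric. *)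
move=> T [Ts TE]; apply/esym; apply: (tensor20_eq_on_lifts hM1 hM2).
move=> al1 be1 al2 be2 al1s be1s al2s be2s /= p.
have [-> -> -> ->] := TE _ _ _ _ al1s be1s al2s be2s p.
rewrite cGE /eval20 !(hlift_form1E hM1) !(vlift_form1E hM2).
have [E11 E22 E12 E21] := evG al1 be1 al2 be2 p.
by split; apply/esym.
Qed.
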